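(* Let $L$ be a finite distributive lattice and $K$ a field. The following are equivalent: (1) $L$ is planar; (2) $L$ is sortable; (3) the defining ideal of $K[\mathcal{C}_L]$ has a quadratic Gröbner basis with respect to a degree reverse lexicographic order (for some ordering of the variables); (4) the defining ideal of $K[\mathcal{C}_L]$ is quadratically generated; (5) $K[\mathcal{C}_L]$ is Koszul; (6) $K[\mathcal{C}_L]$ is a Hibi ring, i.e. isomorphic (as a standard graded $K$-algebra) to the Hibi ring of some finite distributive lattice.
   Context: An ideal of a finite poset $P$ is a downward closed subset; $\mathcal{J}(P)$ is the lattice of ideals ordered by inclusion. Every finite distributive lattice $L$ is $\cong\mathcal{J}(P)$ for a finite poset $P$ unique up to isomorphism; $L$ is planar if $P$ has width (size of the largest antichain) at most $2$. Label the elements of $L$ as variables $t_1,\ldots,t_s$ over $K$. To a maximal chain $C$ of $L$ associate the monomial $t_C=\prod_{t_i\in C}t_i$. The chain algebra $K[\mathcal{C}_L]$ is the $K$-subalgebra of $K[t_1,\ldots,t_s]$ generated by all $t_C$, $C$ a maximal chain of $L$, graded so that each $t_C$ has degree one. Its defining ideal is the kernel of the surjective $K$-algebra homomorphism $K[T_C\mid C \text{ a maximal chain of }L]\to K[\mathcal{C}_L]$, $T_C\mapsto t_C$. The ideal is quadratically generated if it is generated by homogeneous elements of degree $2$, and a Gröbner basis is quadratic if all its elements are homogeneous of degree $2$ (the zero ideal, with empty generating set, is allowed). Sorting: for two monomials $u_1,u_2$ of the same degree $q$ in $K[t_1,\ldots,t_s]$, write $u_1u_2=t_{i_1}t_{i_2}\cdots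 t_{i_{2q}}$ with $i_1\le i_2\le\cdots\le i_{2q}$; then $\operatorname{sort}(u_1,u_2)=(t_{i_1}t_{i_3}\cdots t_{i_{2q-1}},\,t_{i_2}t_{i_4}\cdots t_{i_{2q}})$. A set $B$ of monomials of the same degree is sortable if $\operatorname{sort}(B\times B)\subseteq B\times B$. The lattice $L$ is sortable if there exists a labelling $t_1,\ldots,t_s$ of its elements such that $\{t_C\mid C\text{ is a maximal chain of }L\}$ is a sortable set of monomials. The Hibi ring of a finite distributive lattice $M$ is $K[x_a\mid a\in M]/(x_ax_b-x_{a\wedge b}x_{a\vee b}\mid a,b\in M)$ with the standard grading. *)

(* Defs.v *)
From HB Require Import structures.
From mathcomp Require Import all_boot all_order all_fingroup all_algebra.
From mathcomp Require Import boolp mpoly.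

Set Implicit Arguments.
Unset Strict Implicit.
Unset Printing Implicit Defensive.

Import Order.TTheory GRing.Theory.
Local Open Scope ring_scope.

(* Posets, ideals, planar lattices. A nonempty finite distributive lattice is *)
(* a finTBDistrLatticeType (the lattice of ideals of a poset is nonempty).    *)

Definition order_ideal d (P : finPOrderType d) (I : {set P}) : bool :=
  [forall x in I, forall y : P, (y <= x)%O ==> (y \in I)].

Definition ideal_lattice_iso d (L : finTBDistrLatticeType d)
    d' (P : finPOrderType d') (f : L -> {set P}) : Prop :=
  [/\ {mono f : x y / (x <= y)%O >-> x \subset y},
      forall x, order_ideal (f x)
    & forall I, order_ideal I -> exists x, f x = I].

Definition antichain d (P : finPOrderType d) (A : {set P}) : bool :=
  [forall x in A, forall y in A, (x <= y)%O ==> (x == y)].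

Definition width d (P : finPOrderType d) : nat :=
  \max_(A : {set P} | antichain A) #|A|.

Definition planar d (L : finTBDistrLatticeType d) : Prop :=
  exists (d' : Order.disp_t) (P : finPOrderType d') (f : L -> {set P}),
    ideal_lattice_iso f /\ (width P <= 2)%N.

Definition chain d (L : finPOrderType d) (C : {set L}) : bool :=
  [forall x in C, forall y in C, (x >=< y)%O].

Definition maxchain d (L : finPOrderType d) : finType :=
  {C : {set L} | maxset (@chain d L) C}.

(* The exponent vector of t_C, where the element a of L is labelled by the    *)
(* variable of index lab a.                                                   *)
Definition chain_mnm d (L : finPOrderType d) n (lab : L -> 'I_n) (C : {set L})
    : 'X_{1..n} :=
  (\sum_(a in C) U_(lab a))%MM.

(* Sorting; the list of indices i_1 <= i_2 <= ... of a monomial is            *)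
(* mnm_indices, and its entries i_1, i_3, ... have even 0-based position.     *)

Definition mnm_indices n (m : 'X_{1..n}) : seq 'I_n :=
  flatten [seq nseq (m i) i | i <- enum 'I_n].

Definition indices_mnm n (w : seq 'I_n) : 'X_{1..n} :=
  (\sum_(i <- w) U_(i))%MM.

Definition every_other T (b : bool) (w : seq T) : seq T :=
  mask (mkseq (fun k => odd k == b) (size w)) w.

Definition sort_mnm n (u : 'X_{1..n} * 'X_{1..n}) : 'X_{1..n} * 'X_{1..n} :=
  let w := mnm_indices (u.1 + u.2)%MM in
  (indices_mnm (every_other false w), indices_mnm (every_other true w)).

Definition sortable_set n (B : 'X_{1..n} -> Prop) : Prop :=
  (forall u v, B u -> B v -> mdeg u = mdeg v) /\
  (forall u v, B u -> B v -> B (sort_mnm (u, v)).1 /\ B (sort_mnm (u, v)).2).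

Definition sortable d (L : finTBDistrLatticeType d) : Prop :=
  exists lab : L -> 'I_#|L|, bijective lab /\
    sortable_set (fun u => exists C : maxchain L, u = chain_mnm lab (val C)).

Definition ideal_gen (R : comNzRingType) (S : R -> Prop) (p : R) : Prop :=
  exists (k : nat) (c g : 'I_k -> R),
    (forall i, S (g i)) /\ p = \sum_(i < k) c i * g i.

Section PolynomialIdeals.
Variables (K : fieldType) (n : nat).
Implicit Types (I S : {mpoly K[n]} -> Prop) (p : {mpoly K[n]}).

Definition quadratically_generated I : Prop :=
  exists S, (forall g, S g -> g \is 2.-homog) /\
    (forall p, I p <-> ideal_gen S p).

(* Degree reverse lexicographic order for T_(s 0) > T_(s 1) > ...             *)
Definition drl_lt (s : 'S_n) (u v : 'X_{1..n}) : bool :=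
  (mdeg u < mdeg v)%N ||
  ((mdeg u == mdeg v) &&
   [exists i : 'I_n, (v (s i) < u (s i))%N &&
     [forall j : 'I_n, (i < j)%N ==> (u (s j) == v (s j))]]).

Definition is_initial (lt : rel 'X_{1..n}) p (m : 'X_{1..n}) : Prop :=
  m \in msupp p /\ forall m', m' \in msupp p -> m' != m -> lt m' m.

Definition initial_ideal lt S : {mpoly K[n]} -> Prop :=
  ideal_gen (fun q => exists p m, [/\ S p, is_initial lt p m & q = 'X_[m]]).

Definition groebner_basis lt I (G : seq {mpoly K[n]}) : Prop :=
  (forall g, g \in G -> I g /\ g != 0) /\
  (forall q, initial_ideal lt I q <-> initial_ideal lt (fun g => g \in G) q).

Definition has_quadratic_drl_gb I : Prop :=
  exists (s : 'S_n) (G : seq {mpoly K[n]}),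
    groebner_basis (drl_lt s) I G /\ (forall g, g \in G -> g \is 2.-homog).

End PolynomialIdeals.

(* Standard graded algebras; gr k x means that x is homogeneous of degree k   *)
(* (0 included).                                                              *)

Definition irrelevant_ideal (A : comNzRingType) (gr : nat -> A -> Prop) (x : A)
    : Prop :=
  exists (m : nat) (y : nat -> A),
    (forall k, gr k.+1 (y k)) /\ x = \sum_(k < m) y k.

(* The residue field A / A_+ has a linear free resolution                     *)
(*   ... -> A(-2)^(b 2) -> A(-1)^(b 1) -> A -> A / A_+ -> 0 ;                 *)
(* D i is the matrix of F_(i+1) = A(-i-1)^(b i.+1) -> F_i = A(-i)^(b i),      *)
(* acting on row vectors.                                                     *)
Definition koszul (A : comNzRingType) (gr : nat -> A -> Prop) : Prop :=
  exists (b : nat -> nat) (D : forall i, 'M[A]_(b i.+1, b i)),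
    [/\ b 0%N = 1%N,
        forall i j k, gr 1%N (D i j k),
        forall v : 'rV[A]_(b 0%N),
          (forall j, irrelevant_ideal gr (v ord0 j)) <->
          (exists w, v = w *m D 0%N)
      & forall i (v : 'rV[A]_(b i.+1)),
          v *m D i = 0 <-> (exists w, v = w *m D i.+1)].

Definition graded_iso (K : fieldType) (A B : comAlgType K)
    (grA : nat -> A -> Prop) (grB : nat -> B -> Prop) : Prop :=
  exists f : {lrmorphism A -> B},
    bijective f /\ forall k x, grA k x <-> grB k (f x).

Section ChainAlgebra.
Variables (K : fieldType) (d : Order.disp_t) (L : finTBDistrLatticeType d).

Notation S := {mpoly K[#|L|]}.
Notation T := {mpoly K[#|maxchain L|]}.

Definition chain_monomial (C : maxchain L) : S :=
  'X_[chain_mnm (@enum_rank L) (val C)].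

Definition chain_map (p : T) : S :=
  p \mPo [tuple chain_monomial (enum_val i) | i < #|maxchain L|].

Definition chain_ideal (p : T) : Prop := chain_map p = 0.

Definition chain_subalg : {pred S} := fun f => `[< exists p, f = chain_map p >].

Fact chain_subalg_closed : subalg_closed chain_subalg.
Proof.
split.
- by apply/asboolP; exists 1; rewrite /chain_map comp_mpoly1.
- move=> c _ _ /asboolP[p ->] /asboolP[q ->]; apply/asboolP.
  by exists (c *: p + q); rewrite /chain_map comp_mpolyD comp_mpolyZ.
- move=> _ _ /asboolP[p ->] /asboolP[q ->]; apply/asboolP.
  by exists (p * q); rewrite /chain_map rmorphM.
Qed.

HB.instance Definition _ :=
  GRing.isSubalgClosed.Build K S chain_subalg chain_subalg_closed.

Record chain_algebra := ChainAlgebra {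
  chain_algebra_val :> S;
  _ : chain_algebra_val \in chain_subalg }.

HB.instance Definition _ := [isSub for chain_algebra_val].
HB.instance Definition _ := [Choice of chain_algebra by <:].
HB.instance Definition _ := [SubChoice_isSubComNzRing of chain_algebra by <:].
HB.instance Definition _ := [SubZmodule_isSubLmodule of chain_algebra by <:].
HB.instance Definition _ :=
  [SubNzRing_SubLmodule_isSubLalgebra of chain_algebra by <:].
HB.instance Definition _ := [SubLalgebra_isSubAlgebra of chain_algebra by <:].

Definition chain_grading (k : nat) (x : chain_algebra) : Prop :=
  exists p : T, p \is k.-homog /\ val x = chain_map p.

End ChainAlgebra.

Section HibiRing.
Variables (K : fieldType) (d : Order.disp_t) (M : finTBDistrLatticeType d).

Notation S := {mpoly K[#|M|]}.
Notation x a := ('X_(enum_rank a) : S).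

Definition hibi_relation (q : S) : Prop :=
  exists a b : M,
    q = x a * x b - x (Order.meet a b) * x (Order.join a b).

Definition hibi_ideal : {pred S} := fun p => `[< ideal_gen hibi_relation p >].

Fact hibi_ideal_closed : idealr_closed hibi_ideal.
Proof.
split.
- apply/asboolP; exists 0%N, (fun=> 0), (fun=> 0).
  by split=> [[]//|]; rewrite big_ord0.
- apply/asboolP => -[k [c [g [gP /(congr1 (meval (fun=> 0)))]]]].
  rewrite meval1 raddf_sum /= big1 => [/eqP|i _]; first by rewrite oner_eq0.
  by have [a [b ->]] := gP i; rewrite mevalM mevalB !mevalM !mevalXU !mulr0 subr0 mulr0.
- move=> r _ _ /asboolP[k [c [g [gP ->]]]] /asboolP[k' [c' [g' [gP' ->]]]].
  apply/asboolP; exists (k + k')%N.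
  exists (fun i => match split i with inl j => r * c j | inr j => c' j end).
  exists (fun i => match split i with inl j => g j | inr j => g' j end).
  split=> [i|]; first by case: (split i).
  rewrite big_split_ord mulr_sumr /=; congr (_ + _); apply: eq_bigr => i _.
  + by rewrite (unsplitK (inl i)) mulrA.
  + by rewrite (unsplitK (inr i)).
Qed.

HB.instance Definition _ := isIdealr.Build S hibi_ideal hibi_ideal_closed.

Definition hibi_ring := {ideal_quot hibi_ideal}.

HB.instance Definition _ := GRing.ComNzRing.on hibi_ring.

Definition hibi_pi (p : S) : hibi_ring := (\pi_hibi_ring p)%qT.

Definition hibi_scale (c : K) (x : hibi_ring) : hibi_ring :=
  hibi_pi c%:MP * x.

Fact hibi_scaleA c e x : hibi_scale c (hibi_scale e x) = hibi_scale (c * e) x.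
Proof. by rewrite /hibi_scale mulrA mpolyCM /hibi_pi rmorphM. Qed.

Fact hibi_scale1 : left_id 1 hibi_scale.
Proof. by move=> x; rewrite /hibi_scale /hibi_pi mpolyC1 rmorph1 mul1r. Qed.

Fact hibi_scaleDr : right_distributive hibi_scale +%R.
Proof. by move=> c x y; rewrite /hibi_scale mulrDr. Qed.

Fact hibi_scaleDl x : {morph hibi_scale^~ x : c e / c + e}.
Proof. by move=> c e; rewrite /hibi_scale /hibi_pi mpolyCD rmorphD mulrDl. Qed.

HB.instance Definition _ := GRing.Zmodule_isLmodule.Build K hibi_ring
  hibi_scaleA hibi_scale1 hibi_scaleDr hibi_scaleDl.

Fact hibi_scaleAl (c : K) (x y : hibi_ring) : c *: (x * y) = c *: x * y.
Proof. exact: mulrA. Qed.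

HB.instance Definition _ :=
  GRing.Lmodule_isLalgebra.Build K hibi_ring hibi_scaleAl.
HB.instance Definition _ := GRing.Lalgebra_isComAlgebra.Build K hibi_ring.

Definition hibi_grading (k : nat) (x : hibi_ring) : Prop :=
  exists p : S, p \is k.-homog /\ x = hibi_pi p.

End HibiRing.

(* Main.v *)
Require Import Defs.
From HB Require Import structures.
From mathcomp Require Import all_boot all_order all_fingroup all_algebra.
From mathcomp Require Import boolp mpoly zify ring.

(** Everything is decided by the fibres of the monomial map that sends the
    variable of a maximal chain to the product of the elements of the chain.

    If L is planar, two chains cover its poset of join-irreducible elements
    (two_chain_cover), and L embeds in the plane grid so that the rank is the sum
    of the coordinates.  Maximal chains are then monotone lattice paths.  The
    lower and the upper envelope of two paths are again paths, so that the
    maximal chains form a distributive lattice M, and the product of the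
    monomials of two chains is the product of those of their meet and join.
    Straightening by these relations determines the kernel of the monomial map
    (im_straight, toric_eq0).  Therefore the chain algebra is the Hibi ring of M,
    and the relations form a Gröbner basis when smaller chains are smaller
    variables (standard_drl_lt).  If the elements of L are labelled by rank, and
    by the first coordinate within a rank, sorting two chains gives their meet
    and join (sort_chains).

    Hibi rings are Koszul: the ideals generated by the variables of a poset ideal
    form a Koszul filtration (hibi_colon), and the syzygies of a list with linear
    quotients have linear quotients again (linear_syzygies), which produces the
    infinite linear resolution.

    If L is not planar, there are three incomparable join-irreducible elements,
    and L contains a Boolean interval of rank three (planar_or_cube).  Its atoms
    and coatoms form a hexagon, whose edges extend to six maximal chains that
    agree outside the interval.  The two perfect matchings of the hexagon give
    two cubic monomials u and v in the same fibre, whereas the product of two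
    disjoint edges determines these edges (hex_recombine).  Hence the coefficient
    at u vanishes on everything that the quadrics of the kernel generate, but not
    on u - v (critical_mcoeffM).  This excludes quadratic generation, a quadratic
    Gröbner basis, and, after lifting the first two maps of a linear resolution,
    the Koszul property.  Finally, a sortable labelling would make all pairs of
    disjoint edges of the hexagon interleave, which is impossible for six points
    on a line (hexagon_not_interleaved). *)

Set Implicit Arguments.
Unset Strict Implicit.
Unset Printing Implicit Defensive.

Import Order.TTheory GRing.Theory.
Local Open Scope ring_scope.

(** * Koszul filtrations *)

Section Span.
Variable A : comNzRingType.

(** The recursive form singles out the head of the list, the last generator to
    be added, because syzygies are computed one generator at a time. *)
Fixpoint lspan (V : lmodType A) (vs : seq V) (v : V) : Prop :=
  if vs is u :: us then exists c : A, lspan us (v - c *: u) else v = 0.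

Section Lmod.
Variable V : lmodType A.
Implicit Types (vs : seq V) (u v : V).

Lemma lspan0 vs : lspan vs 0.
Proof. by elim: vs => //= u us IH; exists 0; rewrite scale0r subr0. Qed.

Lemma lspanD vs u v : lspan vs u -> lspan vs v -> lspan vs (u + v).
Proof.
elim: vs u v => [|w ws IH] u v /=; first by move=> -> ->; rewrite addr0.
by move=> [a ua] [b vb]; exists (a + b); rewrite scalerDl opprD addrACA; apply: IH.
Qed.

Lemma lspanZ vs (a : A) v : lspan vs v -> lspan vs (a *: v).
Proof.
elim: vs v => [|w ws IH] v /=; first by move=> ->; rewrite scaler0.
by move=> [b vb]; exists (a * b); rewrite -scalerA -scalerBr; apply: IH.
Qed.

Lemma lspan_sum (I : Type) (r : seq I) (P : pred I) (F : I -> V) vs :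
  (forall i, P i -> lspan vs (F i)) -> lspan vs (\sum_(i <- r | P i) F i).
Proof.
move=> H; apply: (big_ind (lspan vs)) => //; first exact: lspan0.
by move=> x y; apply: lspanD.
Qed.

Lemma lspan_mem vs v : v \in vs -> lspan vs v.
Proof.
elim: vs => //= w ws IH; rewrite inE => /predU1P[->|/IH vw].
  by exists 1; rewrite scale1r subrr; apply: lspan0.
by exists 0; rewrite scale0r subr0.
Qed.

Lemma lspan_ind (P : V -> Prop) vs v :
    P 0 -> (forall a u w, P w -> u \in vs -> P (a *: u + w)) ->
  lspan vs v -> P v.
Proof.
move=> P0 PD; elim: vs v PD => [|w ws IH] v PD /=; first by move=> ->.
move=> [c vc]; rewrite -(subrK (c *: w) v) addrC; apply: (PD); last exact: mem_head.
by apply: IH vc => a u x Px uw; apply: PD => //; rewrite inE uw orbT.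
Qed.

End Lmod.

Lemma lspan_map (V W : lmodType A) (g : {linear V -> W}) (vs : seq V) v :
  injective g -> lspan (map g vs) (g v) <-> lspan vs v.
Proof.
move=> injg; elim: vs v => [|w ws IH] v /=.
  by split=> [gv|->]; [apply: injg; rewrite gv raddf0 | rewrite raddf0].
have gE c : g v - c *: g w = g (v - c *: w).
  by rewrite linearB (linearZ_LR g).
split=> -[c H]; exists c.
  by apply/IH; rewrite -gE.
by rewrite gE; apply/IH.
Qed.

Lemma lspan_map_ex (V W : lmodType A) (g : {linear V -> W}) (vs : seq V) w :
  lspan (map g vs) w <-> exists2 v, lspan vs v & w = g v.
Proof.
split=> [|[v]].
  elim: vs w => [|u us IH] w /=; first by move=> ->; exists 0; rewrite ?raddf0.
  move=> [c /IH[v vus gv]]; exists (v + c *: u).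
    by exists c; rewrite addrK.
  by rewrite linearD (linearZ_LR g) /= -gv subrK.
elim: vs v w => [|u us IH] v w /=; first by move=> -> ->; rewrite raddf0.
move=> [c vc] ->; exists c; apply: (IH (v - c *: u)) => //.
by rewrite linearB (linearZ_LR g).
Qed.

(** Linear quotients relative to a family of ideals, each given by a list of
    generators, as for the members of a Koszul filtration; the generators come
    in the order of lspan, the last one first. *)
Fixpoint linear_quotients (F : seq A -> Prop) (V : lmodType A) (vs : seq V)
    : Prop :=
  if vs is u :: us then
    linear_quotients F us /\
    exists2 w, F w & forall f : A, lspan us (f *: u) <-> lspan (w : seq A^o) f
  else True.

Lemma linear_quotients_map F (V W : lmodType A) (g : {linear V -> W}) vs :
  injective g -> linear_quotients F vs -> linear_quotients F (map g vs).
Proof.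
move=> injg; elim: vs => //= u us IH [/IH Hus [w Fw Hw]]; split=> //.
exists w => // f; have <- : g (f *: u) = f *: g u by rewrite (linearZ_LR g).
by split=> [/(lspan_map _ _ injg)/Hw|/Hw ?] //; apply/lspan_map.
Qed.

Fixpoint rows_mx b (vs : seq 'rV[A]_b) : 'M[A]_(size vs, b) :=
  if vs is u :: us then col_mx u (rows_mx us) : 'M_(1 + size us, b) else 0.

Lemma mulmx_col_mx b n (v : 'rV[A]_(1 + n)) (u : 'rV_b) (M : 'M_(n, b)) :
  v *m col_mx u M = v ord0 (lshift n ord0) *: u + rsubmx v *m M.
Proof.
by rewrite -{1}[v]hsubmxK mul_row_col [lsubmx v]mx11_scalar mul_scalar_mx mxE.
Qed.

Lemma lspan_rows_mx b (vs : seq 'rV[A]_b) v :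
  lspan vs v <-> exists w, v = w *m rows_mx vs.
Proof.
elim: vs v => [|u us IH] v /=.
  split=> [->|[w ->]]; first by exists 0; rewrite mul0mx.
  by rewrite mulmx0.
split=> [[c /IH[w vw]]|[w ->]].
  exists (row_mx c%:M w); rewrite (mul_row_col c%:M) mul_scalar_mx -vw.
  by rewrite addrC subrK.
have -> := mulmx_col_mx (w : 'rV_(1 + size us)) u (rows_mx us).
exists (w ord0 (lshift (size us) ord0 : 'I_(1 + size us))).
by rewrite addrAC subrr add0r; apply/IH; eexists.
Qed.

Lemma rows_mxP (P : A -> Prop) b (vs : seq 'rV[A]_b) :
  (forall u, u \in vs -> forall j, P (u ord0 j)) ->
  forall i j, P (rows_mx vs i j).
Proof.
elim: vs => [|u us IH] /= Pvs i j; first by case: i.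
have {}IH := IH (fun x xu => Pvs x (@mem_behead _ (u :: us) x xu)).
case: (@split_ordP 1 (size us) i) => k ->; last by rewrite (col_mxEd u).
by rewrite (col_mxEu u) ord1; apply: Pvs; rewrite mem_head.
Qed.

End Span.

(** What the construction of linear resolutions uses of a grading: the component
    A1 of degree 1 and the projections p1 and p2 onto the components of degree
    1 and 2. *)
Definition linear_projections (A : comNzRingType) (A1 : A -> Prop)
    (p1 : A -> A) (p2 : {additive A -> A}) : Prop :=
  [/\ forall a, A1 (p1 a), forall a, A1 a -> p1 a = a
    & forall a b, A1 b -> p2 (a * b) = p1 a * b].

Section KoszulFiltration.
Variables (A : comNzRingType) (gr : nat -> A -> Prop).
Variables (p1 : A -> A) (p2 : {additive A -> A}).
Hypothesis pP : linear_projections (gr 1) p1 p2.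
Hypotheses (gr0 : gr 1 0) (grN : forall a, gr 1 a -> gr 1 (- a)).

Variable F : seq A -> Prop.
Hypothesis F_lin : forall w, F w -> forall a, a \in w -> gr 1 a.
Hypothesis F_quot : forall w, F w -> linear_quotients F (w : seq A^o).

Definition linear_row b (v : 'rV[A]_b) := forall j, gr 1 (v ord0 j).

(** Linear coefficients are obtained by taking the component of degree two of
    an equation between vectors. *)
Lemma lspan_linear b (vs : seq 'rV[A]_b) (x : A) (u : 'rV[A]_b) :
    (forall v, v \in vs -> linear_row v) -> gr 1 x -> linear_row u ->
    lspan vs (x *: u) ->
  exists c : 'rV_(size vs), linear_row c /\ x *: u = c *m rows_mx vs.
Proof.
have [p1gr p1id p2M] := pP.
move=> vs1 x1 u1 /lspan_rows_mx[c def_xu].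
exists (map_mx p1 c); split=> [j|]; first by rewrite mxE; apply: p1gr.
apply/rowP => j; have /rowP/(_ j) := def_xu; rewrite !mxE => def_xuj.
have -> : x * u ord0 j = p2 (x * u ord0 j) by rewrite p2M // p1id.
rewrite def_xuj raddf_sum; apply: eq_bigr => k _ /=; rewrite mxE p2M //.
exact: rows_mxP.
Qed.

(** Syzygies of a linear quotient list are again generated by a linear quotient
    list of linear rows.  By induction the syzygies of the tail are, and those
    whose first coordinate is nonzero have this coordinate in the colon ideal
    of the head, generated by a member w of F; each entry x of w lifts to a
    linear syzygy with first coordinate x, and the colon ideals of these lifts
    are the colon ideals of the entries of w. *)
Lemma linear_syzygies b (vs : seq 'rV[A]_b) :
    (forall v, v \in vs -> linear_row v) -> linear_quotients F vs ->
  exists us : seq 'rV[A]_(size vs),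
    [/\ forall u, u \in us -> linear_row u, linear_quotients F us
      & forall v, lspan us v <-> v *m rows_mx vs = 0].
Proof.
elim: vs => [|r vs IH] /= vs1.
  move=> _; exists [::]; split=> //= v.
  by split=> [->|_]; [rewrite mul0mx | apply: thinmx0].
case=> /IH{IH}[]; first by move=> v vvs; apply: vs1; rewrite inE vvs orbT.
move=> us [us1 us_quot us_ker] [w Fw r_colon].
have r1 : linear_row r by apply: vs1; rewrite mem_head.
have {}vs1 v : v \in vs -> linear_row v.
  by move=> vvs; apply: vs1; rewrite inE vvs orbT.
have F_quot_w := F_quot Fw; have F_lin_w := F_lin Fw.
pose n := size vs; pose R : 'M[A]_(1 + n, b) := col_mx r (rows_mx vs).
suff [us' [us'1 us'_quot us'_ker]] : exists us' : seq 'rV[A]_(1 + n),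
   [/\ forall u, u \in us' -> linear_row u, linear_quotients F us'
     & forall v, lspan us' v <->
         v *m R = 0 /\ lspan (w : seq A^o) (v ord0 (lshift n ord0))].
  exists us'; split=> // v; split=> [/us'_ker[]//|vR]; apply/us'_ker; split=> //.
  apply/r_colon/lspan_rows_mx; exists (- rsubmx (v : 'rV_(1 + n))).
  by move: vR; rewrite mulmx_col_mx => /eqP; rewrite addr_eq0 mulNmx => /eqP.
have wr x : x \in w -> lspan vs (x *: r).
  by move=> xw; apply/r_colon; apply: (@lspan_mem _ A^o).
elim: w F_quot_w F_lin_w wr {Fw r_colon} => [|x w IH] /=.
  move=> _ _ _; pose emb (u : 'rV[A]_n) : 'rV[A]_(1 + n) := row_mx 0 u.
  have emb_lin : linear emb.
    by move=> a u v; rewrite /emb scale_row_mx add_row_mx scaler0 addr0.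
  pose embL : {linear 'rV[A]_n -> 'rV[A]_(1 + n)} :=
    HB.pack emb (GRing.isLinear.Build _ _ _ _ emb emb_lin).
  exists (map embL us); split.
  - move=> _ /mapP[u uus ->] j; case: (split_ordP j) => k ->.
      by rewrite row_mxEl mxE.
    by rewrite row_mxEr; apply: us1.
  - by apply: (linear_quotients_map (g := embL)) us_quot => u v /eq_row_mx[].
  move=> v; rewrite mulmx_col_mx; split=> [/lspan_map_ex[u /us_ker uR ->]|].
    by rewrite row_mxKr row_mxEl mxE scale0r add0r.
  case=> + v0; rewrite v0 scale0r add0r => /us_ker vR.
  apply/lspan_map_ex; exists (rsubmx (v : 'rV_(1 + n))) => //.
  rewrite -{1}[v]hsubmxK; congr row_mx.
  by rewrite [lsubmx v]mx11_scalar mxE v0 raddf0.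
case=> w_quot [w' Fw' x_colon] xw_lin xw_r.
have [||us' [us'1 us'_quot us'_ker]] := IH w_quot.
- by move=> y yw; apply: xw_lin; rewrite inE yw orbT.
- by move=> y yw; apply: xw_r; rewrite inE yw orbT.
have x1 : gr 1 x by apply: xw_lin; rewrite mem_head.
have [c [c1 xrE]] := lspan_linear vs1 x1 r1 (xw_r x (mem_head _ _)).
pose g : 'rV[A]_(1 + n) := row_mx x%:M (- c).
have gR : g *m R = 0 by rewrite mul_row_col mul_scalar_mx mulNmx xrE subrr.
have g0 : g ord0 (lshift n ord0) = x by rewrite row_mxEl mxE eqxx mulr1n.
have subgE v a : (v - a *: g) ord0 (lshift n ord0) = v ord0 (lshift n ord0) - a * x.
  by rewrite -g0 !mxE.
exists (g :: us'); split=> [u||v] /=.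
- rewrite inE => /predU1P[->|/us'1//] j; case: (split_ordP j) => k ->.
    by rewrite row_mxEl !ord1 mxE eqxx mulr1n.
  by rewrite row_mxEr mxE; apply: grN.
- split=> //; exists w' => // f; split=> [/us'_ker[_]|fw'].
    by rewrite mxE g0 => /x_colon.
  by apply/us'_ker; rewrite -scalemxAl gR scaler0 mxE g0; split=> //; apply/x_colon.
split=> [[a /us'_ker[]]|[vR [a va]]].
  rewrite mulmxBl -scalemxAl gR scaler0 subr0 => vR; rewrite subgE => va.
  by split=> //; exists a.
exists a; apply/us'_ker; split; last by rewrite subgE.
by rewrite mulmxBl -scalemxAl gR scaler0 subr0.
Qed.

(** One step of the resolution: a map of free modules together with what is
    needed to continue. *)
Record linear_stage := LinearStage {
  stage_rank : nat;
  stage_rows : seq 'rV[A]_stage_rank;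
  stage_linear : forall v, v \in stage_rows -> linear_row v;
  stage_quot : linear_quotients F stage_rows }.

Definition syzygies (s : linear_stage) :=
  sval (cid (linear_syzygies (@stage_linear s) (@stage_quot s))).

Lemma syzygiesP (s : linear_stage) :
  [/\ forall u, u \in syzygies s -> linear_row u, linear_quotients F (syzygies s)
    & forall v, lspan (syzygies s) v <-> v *m rows_mx (stage_rows s) = 0].
Proof. exact: (svalP (cid (linear_syzygies _ _))). Qed.

Definition next_stage (s : linear_stage) : linear_stage :=
  LinearStage (let: And3 us1 _ _ := syzygiesP s in us1)
              (let: And3 _ us_quot _ := syzygiesP s in us_quot).

(** Iterated syzygies resolve the residue field, starting from the generators
    w of the irrelevant ideal; all matrices are linear by construction. *)
Theorem koszul_filtration (w : seq A) :
    F w -> (forall f, irrelevant_ideal gr f <-> lspan (w : seq A^o) f) ->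
  koszul gr.
Proof.
move=> Fw irrE.
have scal_lin : linear (scalar_mx : A^o -> 'rV[A]_1).
  by move=> a u v; rewrite raddfD /= scale_scalar_mx.
pose scal : {linear A^o -> 'rV[A]_1} :=
  HB.pack (scalar_mx : A^o -> 'rV[A]_1) (GRing.isLinear.Build _ _ _ _ _ scal_lin).
have scal_inj : injective scal.
  by move=> a b /matrixP/(_ 0 0); rewrite !mxE.
have s1 v : v \in map scal w -> linear_row v.
  by case/mapP => a aw -> j; rewrite (ord1 j) mxE; apply: (F_lin Fw).
pose s0 := LinearStage s1 (linear_quotients_map scal_inj (F_quot Fw)).
pose st i := iter i next_stage s0.
exists (fun i => stage_rank (st i)), (fun i => rows_mx (stage_rows (st i))).
split=> //.
- by move=> i j k; apply: rows_mxP => v; apply: stage_linear.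
- move=> v; have -> : v = scal (v ord0 ord0) by apply/rowP => j; rewrite ord1 mxE.
  split=> [/(_ ord0)|vw j]; first rewrite mxE.
    by move/irrE/(lspan_map _ _ scal_inj)/lspan_rows_mx.
  by rewrite (ord1 j) mxE; apply/irrE/(lspan_map _ _ scal_inj)/lspan_rows_mx.
move=> i v; have [_ _ syzP] := syzygiesP (st i).
by split=> [/syzP/lspan_rows_mx|?] //; apply/syzP/lspan_rows_mx.
Qed.

End KoszulFiltration.

(** * Kernels of monomial maps *)

Lemma mnm_neq0 n (m : 'X_{1..n}) : m != 0%MM -> exists i, m i != 0%N.
Proof.
move=> m0; apply/existsP; apply: contraNT m0; rewrite negb_exists => /forallP Hm.
by apply/eqP/mnmP => i; rewrite mnm0E; have /negPn/eqP := Hm i.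
Qed.

Lemma var_dvd n (m : 'X_{1..n}) i : m i != 0%N -> m = (U_(i) + (m - U_(i)))%MM.
Proof.
move=> mi; rewrite addmC submK //; apply/mnm_lepP => j; rewrite mnm1E.
by case: eqP => // <-; rewrite lt0n.
Qed.

Section MonomialMap.
Variables (K : fieldType) (T : finType) (s : nat) (e : T -> 'X_{1..s}).
Notation n := #|T|.
Implicit Types (m : 'X_{1..n}) (p : {mpoly K[n]}).

Definition monomial_tuple := [tuple ('X_[e (enum_val i)] : {mpoly K[s]}) | i < n].
Notation toric p := (p \mPo monomial_tuple).

Definition mnm_image m : 'X_{1..s} := (\sum_(i < n) e (enum_val i) *+ m i)%MM.

Lemma mnm_imageE m k : mnm_image m k = (\sum_(i < n) e (enum_val i) k * m i)%N.
Proof. by rewrite mnm_sumE; apply: eq_bigr => i _; rewrite mulmnE. Qed.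

Lemma mnm_image0 : mnm_image 0 = 0%MM.
Proof.
by apply/mnmP => k; rewrite mnm_imageE mnm0E big1 // => i _; rewrite mnm0E muln0.
Qed.

Lemma mnm_imageD m m' : mnm_image (m + m')%MM = (mnm_image m + mnm_image m')%MM.
Proof.
apply/mnmP => k; rewrite mnmDE !mnm_imageE -big_split.
by apply: eq_bigr => i _; rewrite mnmDE mulnDr.
Qed.

Lemma mnm_imageU a : mnm_image U_(enum_rank a)%MM = e a.
Proof.
apply/mnmP => k; rewrite mnm_imageE (bigD1 (enum_rank a)) //= enum_rankK.
rewrite mnm1E eqxx muln1 big1 ?addn0 // => i /negPf i_a.
by rewrite mnm1E eq_sym i_a muln0.
Qed.

Lemma toricX m : toric 'X_[m] = 'X_[mnm_image m].
Proof.
rewrite comp_mpolyX /mnm_image (big_morph _ (@mpolyXD s K) (@mpolyX0 s K)).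
by apply: eq_bigr => i _; rewrite tnth_mktuple mpolyXn.
Qed.

Lemma mcoeff_toric p v :
  (toric p)@_v = \sum_(m <- msupp p | mnm_image m == v) p@_m.
Proof.
rewrite comp_mpolyEX raddf_sum /= [RHS]big_mkcond /=.
apply: eq_bigr => m _; rewrite toricX mcoeffZ mcoeffX.
by case: eqP; rewrite ?mulr1 ?mulr0.
Qed.

(** A polynomial of the kernel cannot contain a monomial that is alone in its
    fibre. *)
Definition rigid m := forall m', mnm_image m' = mnm_image m -> m' = m.

Lemma rigid_mcoeff p m : toric p = 0 -> rigid m -> p@_m = 0.
Proof.
move=> p0 rm; have := mcoeff_toric p (mnm_image m); rewrite p0 mcoeff0.
have [mp|/memN_msupp_eq0//] := boolP (m \in msupp p).
rewrite big_mkcond (bigD1_seq m) ?msupp_uniq //= eqxx big1 ?addr0 // => m' m'm.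
by case: eqP => // /rm m'E; rewrite m'E eqxx in m'm.
Qed.

Lemma rigid_dvd m m' : (m <= m')%MM -> rigid m' -> rigid m.
Proof.
move=> mm' rm' m1 m1m; apply: (@addmI _ (m' - m)%MM).
rewrite [in RHS]submK //; apply: rm'.
by rewrite -[in RHS](submK mm') !mnm_imageD m1m.
Qed.

(** The binomial of such a pair is a minimal generator of the kernel, because
    no proper divisor of either monomial can be exchanged for another one. *)
Definition critical_pair u v :=
  [/\ mnm_image u = mnm_image v, u != v, (2 < mdeg u)%N /\ (2 < mdeg v)%N,
      forall m, (m <= u)%MM -> m != u -> rigid m
    & forall m, (m <= v)%MM -> m != v -> rigid m].

Lemma critical_pair_sym u v : critical_pair u v -> critical_pair v u.
Proof. by case=> uv neq_uv [? ?] ? ?; split=> //; rewrite eq_sym. Qed.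

Section CriticalPair.
Variables (u v : 'X_{1..n}) (uvP : critical_pair u v).

Lemma binomial_ker : toric ('X_[u] - 'X_[v]) = 0.
Proof. by rewrite raddfB /= !toricX; case: uvP => ->; rewrite subrr. Qed.

Lemma binomial_coef : ('X_[u] - 'X_[v] : {mpoly K[n]})@_u = 1.
Proof.
case: uvP => _ /negPf uv _ _ _.
by rewrite mcoeffB !mcoeffX eqxx eq_sym uv subr0.
Qed.

(** The coefficient at u is a linear form that sees the kernel only through
    its minimal generators. *)
Lemma critical_mcoeffM (x p : {mpoly K[n]}) :
  toric p = 0 -> (x * p)@_u = x@_0 * p@_u.
Proof.
case: uvP => _ _ _ uR _ p0; rewrite mcoeffM.
have lt_u : (mdeg u < (mdeg u).+1)%N by [].
have lt_0 : (mdeg (0%MM : 'X_{1..n}) < (mdeg u).+1)%N by rewrite mdeg0.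
rewrite (bigD1 (BMultinom lt_0, BMultinom lt_u)) /= ?add0m //.
rewrite big1 ?addr0 // => -[k1 k2] /= /andP[/eqP uE neq].
have k2u : (k2 <= u)%MM by rewrite [X in (_ <= X)%MM]uE lem_addl.
rewrite [p@_k2]rigid_mcoeff ?mulr0 //; apply: uR => //.
apply: contraNneq neq => k2E; rewrite xpair_eqE -!val_eqE /= k2E eqxx andbT.
by rewrite -(addIm (etrans (add0m u) (etrans uE (congr1 _ k2E)))).
Qed.

Lemma critical_not_quadratic :
  ~ quadratically_generated (fun p => toric p = 0).
Proof.
case=> S [S2 SP]; have [k [c [g [Sg fE]]]] := (SP _).1 binomial_ker.
have : ('X_[u] - 'X_[v] : {mpoly K[n]})@_u = 0.
  rewrite fE raddf_sum big1 //= => i _; rewrite critical_mcoeffM.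
    rewrite [(g i)@_u](dhomog_nemf_coeff (S2 _ (Sg i))) ?mulr0 //.
    by case: uvP => _ _ [u3 _] _ _; rewrite gtn_eqF.
  apply/SP; exists 1%N, (fun=> 1), (fun=> g i); split=> [_|]; first exact: Sg.
  by rewrite big_ord1 mul1r.
by rewrite binomial_coef => /eqP; rewrite oner_eq0.
Qed.

End CriticalPair.

Lemma drl_lt_total (σ : 'S_n) m m' : m != m' -> drl_lt σ m m' || drl_lt σ m' m.
Proof.
move=> neq; rewrite /drl_lt; case: ltngtP => //= _.
have [i0 i0P] : exists i, m (σ i) != m' (σ i).
  apply/existsP; apply: contraNT neq; rewrite negb_exists => /forallP eqm.
  apply/eqP/mnmP => j; have /negPn/eqP := eqm ((σ^-1)%g j).
  by rewrite permKV.
case: (@arg_maxnP _ i0 (fun i => m (σ i) != m' (σ i)) (fun i => i) i0P) => i neqi maxi.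
have eq_after (j : 'I_n) : (i < j)%N -> m (σ j) = m' (σ j).
  by move=> ij; apply: contraTeq ij => /maxi; rewrite -leqNgt.
case: (ltngtP (m (σ i)) (m' (σ i))) (neqi) => // lt _; apply/orP; [right|left];
apply/existsP; exists i; rewrite lt /=; apply/forallP => j; apply/implyP => ij;
by rewrite eq_after.
Qed.

(** The leading monomial of the binomial is u or v, and a quadratic leading
    monomial that divides it properly would be alone in its fibre. *)
Lemma critical_no_quadratic_gb u v :
  critical_pair u v -> ~ has_quadratic_drl_gb (fun p => toric p = 0).
Proof.
move=> uvP [σ [G [[GI GP] G2]]].
have wlog_lt w w' : critical_pair w w' -> drl_lt σ w' w -> False.
  move=> ww'P lt_ww'; have [ww' neq [w3 _] wR _] := ww'P.
  have [k [c [g [gP XwE]]]] :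
      initial_ideal (drl_lt σ) (fun g => g \in G) ('X_[w] : {mpoly K[n]}).
    apply/GP; exists 1%N, (fun=> 1), (fun=> 'X_[w]); split=> [_|]; last first.
      by rewrite big_ord1 mul1r.
    exists ('X_[w] - 'X_[w']), w; split=> //.
      exact: binomial_ker ww'P.
    have coefE m : ('X_[w] - 'X_[w'] : {mpoly K[n]})@_m = (w == m)%:R - (w' == m)%:R.
      by rewrite mcoeffB !mcoeffX.
    split=> [|m].
      by rewrite mcoeff_msupp coefE eqxx [w' == w]eq_sym (negPf neq) subr0 oner_eq0.
    rewrite mcoeff_msupp coefE => + /negPf; rewrite [m == w]eq_sym => + wm.
    by rewrite wm; case: (w' =P m) => [<-|]; rewrite // subrr eqxx.
  have : ('X_[w] : {mpoly K[n]})@_w != 0 by rewrite mcoeffX eqxx oner_eq0.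
  rewrite XwE raddf_sum /= => /eqP; apply; apply: big1 => i _.
  have [f [m [fG [mf _] ->]]] := gP i.
  have m2 : mdeg m = 2 := dhomog_mf (G2 _ fG) mf.
  have [mw|Nmw] := boolP (m <= w)%MM; last first.
    apply/eqP; rewrite mcoeff_eq0; apply: contra Nmw.
    by rewrite (perm_mem (msuppMX _ _)) => /mapP[m' _ ->]; rewrite lem_addr.
  move: mf; rewrite mcoeff_msupp rigid_mcoeff ?eqxx //; first by have [] := GI _ fG.
  by apply: wR => //; apply: contraTneq w3 => <-; rewrite m2.
have [_ neq _ _ _] := uvP.
by case/orP: (drl_lt_total σ neq); apply: wlog_lt => //; apply: critical_pair_sym.
Qed.

(** A linear resolution over the quotient by the kernel is incompatible with a
    critical pair.  Write u = x u' and v = y v' with variables x, y and express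
    x and y through the linear forms d_j of the first matrix; modulo the kernel
    times variables the binomial u - v becomes a combination of the d_j whose
    coefficients form a syzygy.  This syzygy comes from the second matrix, hence
    u - v is a combination of quadrics of the kernel and of multiples of
    variables by elements of the kernel, and its coefficient at u vanishes. *)
Lemma critical_not_koszul (A : comNzRingType) (gr : nat -> A -> Prop)
    (π : {rmorphism {mpoly K[n]} -> A}) u v :
    critical_pair u v ->
    (forall p, π p = 0 <-> toric p = 0) ->
    (forall a, exists p, a = π p) ->
    (forall k a, gr k a <-> exists2 p, p \is k.-homog & a = π p) ->
  ~ koszul gr.
Proof.
move=> uvP kerπ surj grE [b [D [b0 Dlin D0 Dex]]].
have [_ neq [u3 v3] _ _] := uvP.
have lifts i j k : exists p, p \is 1.-homog /\ D i j k = π p.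
  by have /grE[p] := Dlin i j k; exists p.
pose l i j k := sval (cid (lifts i j k)).
have l1 i j k : l i j k \is 1.-homog by case: (svalP (cid (lifts i j k))).
have lE i j k : π (l i j k) = D i j k by case: (svalP (cid (lifts i j k))).
have l0 i j k : (l i j k)@_0 = 0.
  by apply: (dhomog_nemf_coeff (l1 i j k)); rewrite /= mdeg0.
pose c0 : 'I_(b 0) := cast_ord (esym b0) ord0.
have var_lin (x : 'I_n) : exists W : 'I_(b 1) -> {mpoly K[n]},
    toric ('X_x - \sum_j W j * l 0 j c0) = 0.
  have [|w /rowP/(_ c0)] := (D0 (const_mx (π 'X_x))).1.
    move=> j; rewrite mxE; exists 1%N, (fun k => if k is 0 then π 'X_x else 0).
    split=> [[|k]|]; last by rewrite big_ord1.
      by apply/grE; exists 'X_x; rewrite // dhomogX /= mdeg1.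
    by apply/grE; exists 0; rewrite ?dhomog0 ?rmorph0.
  rewrite !mxE => xE; pose W j := sval (cid (surj (w ord0 j))).
  exists W; apply/kerπ; rewrite rmorphB rmorph_sum /= xE -sumrB big1 // => j _.
  by rewrite rmorphM lE -(svalP (cid (surj (w ord0 j)))) subrr.
have split_var m : (2 < mdeg m)%N -> exists x m',
    m = (U_(x) + m')%MM /\ ('X_[m'] : {mpoly K[n]})@_0 = 0.
  move=> m3; have [x mx] : exists x, m x != 0%N.
    by apply: mnm_neq0; apply: contraTneq m3 => ->; rewrite mdeg0.
  have mE := var_dvd mx; exists x, (m - U_(x))%MM; split=> //.
  by rewrite mcoeffX; case: eqP => // m'0; move: m3; rewrite mE m'0 addm0 mdeg1.
have [x [u' [uE u'0]]] := split_var u u3; have [y [v' [vE v'0]]] := split_var v v3.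
have [Wx Wxker] := var_lin x; have [Wy Wyker] := var_lin y.
pose V j : {mpoly K[n]} := 'X_[u'] * Wx j - 'X_[v'] * Wy j.
pose rx : {mpoly K[n]} := 'X_x - \sum_j Wx j * l 0 j c0.
pose ry : {mpoly K[n]} := 'X_y - \sum_j Wy j * l 0 j c0.
have FE : 'X_[u] - 'X_[v] = 'X_[u'] * rx - 'X_[v'] * ry + \sum_j V j * l 0 j c0.
  rewrite uE vE !mpolyXD /rx /ry /V !mulrBr !mulr_sumr.
  under [X in _ = _ + X]eq_bigr do rewrite mulrBl -!mulrA.
  rewrite sumrB; set a := \sum_(j < _) _; set c := \sum_(j < _) _.
  by ring.
have FV : \sum_j V j * l 0 j c0 = 'X_[u] - 'X_[v] - ('X_[u'] * rx - 'X_[v'] * ry).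
  by rewrite FE [X in X - _]addrC addrK.
have rxker : toric rx = 0 by []; have ryker : toric ry = 0 by [].
clearbody rx ry.
have : (\row_j π (V j)) *m D 0 = 0.
  apply/rowP => c; rewrite !mxE; have -> : c = c0.
    by apply: val_inj; case: c => [[|c]] //=; rewrite [X in (_ < X)%N]b0.
  under eq_bigr do rewrite mxE -lE -rmorphM.
  rewrite -rmorph_sum FV; apply/kerπ; rewrite !comp_mpolyB !rmorphM /=.
  rewrite rxker ryker !mulr0 !subr0 !toricX.
  by case: uvP => ->; rewrite subrr.
case/(Dex 0) => w /rowP wE.
pose W k := sval (cid (surj (w ord0 k))).
have WE k : w ord0 k = π (W k) by apply: (svalP (cid (surj (w ord0 k)))).
pose κ j := V j - \sum_k W k * l 1 k j.
have κker j : toric (κ j) = 0.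
  apply/kerπ; rewrite rmorphB rmorph_sum /=; move: (wE j); rewrite !mxE => ->.
  by rewrite -sumrB big1 // => k _; rewrite rmorphM lE WE subrr.
pose q k := \sum_j l 1 k j * l 0 j c0.
have q2 k : q k \is 2.-homog.
  by apply: rpred_sum => j _; apply: (dhomogM (l1 1%N k j) (l1 0 j c0)).
have qker k : toric (q k) = 0.
  apply/kerπ; rewrite rmorph_sum /=.
  have /rowP/(_ c0) : row k (D 1) *m D 0 = 0.
    by apply/(Dex 0); exists (delta_mx 0 k); rewrite rowE.
  rewrite mxE mxE => sum0; rewrite -[RHS]sum0; apply: eq_bigr => j _.
  by rewrite rmorphM !lE mxE.
have VE : \sum_j V j * l 0 j c0 = \sum_k W k * q k + \sum_j l 0 j c0 * κ j.
  under [X in _ + X]eq_bigr do rewrite /κ mulrBr [_ * V _]mulrC.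
  rewrite sumrB addrCA -[LHS]addr0; congr (_ + _); apply/esym/eqP.
  rewrite subr_eq0; apply/eqP; under eq_bigr do rewrite mulr_sumr.
  rewrite exchange_big /=; apply: eq_bigr => j _; rewrite mulr_sumr.
  by apply: eq_bigr => k _; rewrite [RHS]mulrC mulrA.
have := congr1 (mcoeff u) FE; rewrite (binomial_coef uvP) VE !mcoeffD mcoeffN.
rewrite !(critical_mcoeffM uvP) // u'0 v'0 !mul0r subr0 add0r !raddf_sum /=.
rewrite !big1 ?addr0 => [/eqP||k _]; first by rewrite oner_eq0.
  by move=> j _; rewrite (critical_mcoeffM uvP) // l0 mul0r.
rewrite (critical_mcoeffM uvP) // (dhomog_nemf_coeff (q2 k)) ?mulr0 //.
by rewrite gtn_eqF.
Qed.

End MonomialMap.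

(** * Ideals generated by Hibi relations *)

Section IdealGen.
Variable R : comNzRingType.
Implicit Types (S : R -> Prop) (p q : R).

Lemma ideal_gen0 S : ideal_gen S 0.
Proof.
by exists 0%N, (fun=> 0), (fun=> 0); split=> [[]//|]; rewrite big_ord0.
Qed.

Lemma ideal_genM S c p : ideal_gen S p -> ideal_gen S (c * p).
Proof.
move=> [k [a [g [Sg ->]]]]; exists k, (fun i => c * a i), g; split=> //.
by rewrite mulr_sumr; apply: eq_bigr => i _; rewrite mulrA.
Qed.

Lemma ideal_genD S p q : ideal_gen S p -> ideal_gen S q -> ideal_gen S (p + q).
Proof.
move=> [k [a [g [Sg ->]]]] [l [b [h [Sh ->]]]].
exists (k + l)%N, (fun i => match split i with inl j => a j | inr j => b j end).
exists (fun i => match split i with inl j => g j | inr j => h j end).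
split=> [i|]; first by case: (split i).
rewrite big_split_ord /=; congr (_ + _); apply: eq_bigr => i _.
  by rewrite (unsplitK (inl i)).
by rewrite (unsplitK (inr i)).
Qed.

Lemma mem_ideal_gen S p : S p -> ideal_gen S p.
Proof.
move=> Sp; exists 1%N, (fun=> 1), (fun=> p); split=> //.
by rewrite big_ord1 mul1r.
Qed.

Lemma ideal_gen_trans S S' p :
  (forall g, S g -> ideal_gen S' g) -> ideal_gen S p -> ideal_gen S' p.
Proof.
move=> SS' [k [c [g [Sg ->]]]].
apply: (big_ind (ideal_gen S')) => [|x y|i _]; first exact: ideal_gen0.
  exact: ideal_genD.
by apply/ideal_genM/SS'/Sg.
Qed.

End IdealGen.

Section LinearExtension.
Variables (d : Order.disp_t) (M : finPOrderType d).

(** Largest elements come first, so that the tails of the list are poset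
    ideals, in accordance with the order of generators in lspan. *)
Lemma linear_extension :
  exists2 w : seq M, perm_eq w (enum M) & pairwise (fun a b => ~~ (a < b)%O) w.
Proof.
pose h (a : M) := #|[set b | (b < a)%O]|.
have h_lt a b : (a < b)%O -> (h a < h b)%N.
  move=> ab; apply/proper_card/properP; split.
    by apply/subsetP => c; rewrite !inE => /lt_trans; apply.
  by exists a; rewrite inE ?ltxx.
exists (sort (relpre h geq) (enum M)); first by rewrite perm_sort.
rewrite (@sub_pairwise _ (relpre h geq)) //.
  by move=> a b /=; apply: contraTN => /h_lt; rewrite -ltnNge.
rewrite -sorted_pairwise; last by move=> a b c /= ab bc; apply: leq_trans bc ab.
by apply: sort_sorted => a b; apply: leq_total.
Qed.

End LinearExtension.

Section HibiPi.
Variables (K : fieldType) (d : Order.disp_t) (M : finTBDistrLatticeType d).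

HB.instance Definition _ :=
  GRing.RMorphism.copy (@hibi_pi K d M) \pi_(hibi_ring K M)%qT.

Lemma hibi_pi_eq0 p : hibi_pi p = 0 <-> ideal_gen (@hibi_relation K d M) p.
Proof.
have pE : (p \in @hibi_ideal K d M) = (hibi_pi p == hibi_pi 0 :> hibi_ring K M).
  by have := Quotient.idealrBE (@hibi_ideal K d M) p 0; rewrite subr0.
rewrite raddf0 in pE; split=> [/eqP|pI]; first by rewrite -pE => /asboolP.
by apply/eqP; rewrite -pE; apply/asboolP.
Qed.

Lemma hibi_pi_surj (f : hibi_ring K M) : exists p, f = hibi_pi p.
Proof. by exists (generic_quotient.repr f); rewrite /hibi_pi reprK. Qed.

Lemma hibi_piZ c p : hibi_pi (c *: p) = c *: (hibi_pi p : hibi_ring K M).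
Proof. by rewrite -mul_mpolyC rmorphM. Qed.

End HibiPi.

Section HibiExponents.
Variables (K : fieldType) (d : Order.disp_t) (M : finTBDistrLatticeType d).
Variables (s : nat) (e : M -> 'X_{1..s}).
Notation n := #|M|.
Notation var a := (U_(enum_rank a)%MM : 'X_{1..n}).
Notation toric p := (p \mPo monomial_tuple K e).
Notation im := (mnm_image e).
Implicit Types (m : 'X_{1..n}) (a b c : M) (p : {mpoly K[n]}).

(** What a toric realization of the Hibi ring needs.  Modular exponents make
    the monomial map kill the Hibi relations; the last condition lets the image
    of a monomial determine its least factor, if it has one, which makes the
    result of straightening unique. *)
Definition hibi_exponents :=
  [/\ forall a b, (e a + e b = e (Order.meet a b) + e (Order.join a b))%MM,
      forall a, e a != 0%MM
    & forall m m' a, im m = im m' -> m (enum_rank a) != 0%N ->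
        (forall b, m (enum_rank b) != 0%N -> (a <= b)%O) ->
        forall b, m' (enum_rank b) != 0%N -> (a <= b)%O].

Hypothesis eP : hibi_exponents.

(** The degree is carried along so that monomials with the same image turn out
    to have the same degree. *)
Definition straight_equiv m m' :=
  [/\ hibi_pi 'X_[m] = hibi_pi 'X_[m'] :> hibi_ring K M, im m = im m'
    & mdeg m = mdeg m'].

Lemma straight_refl m : straight_equiv m m. Proof. by []. Qed.

Lemma straight_sym m m' : straight_equiv m m' -> straight_equiv m' m.
Proof. by case. Qed.

Lemma straight_trans m m' m'' :
  straight_equiv m m' -> straight_equiv m' m'' -> straight_equiv m m''.
Proof. by move=> [p1 i1 d1] [p2 i2 d2]; split; apply: etrans; eassumption. Qed.

Lemma straight_add m m' m0 :
  straight_equiv m m' -> straight_equiv (m0 + m)%MM (m0 + m')%MM.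
Proof.
case=> eq_pi eq_im eq_deg; split; last by rewrite !mdegD eq_deg.
  by rewrite !mpolyXD !rmorphM /= eq_pi.
by rewrite !mnm_imageD eq_im.
Qed.

Lemma straight_relation a b :
  straight_equiv (var a + var b)%MM (var (Order.meet a b) + var (Order.join a b))%MM.
Proof.
case: eP => mod_e _ _; split; last by rewrite !mdegD !mdeg1.
  apply/eqP; rewrite -subr_eq0 -raddfB; apply/eqP/hibi_pi_eq0/mem_ideal_gen.
  by exists a, b; rewrite !mpolyXD.
by rewrite !mnm_imageD !mnm_imageU mod_e.
Qed.

Lemma mem_varD a m b :
  ((var a + m)%MM (enum_rank b) != 0%N) = (b == a) || (m (enum_rank b) != 0%N).
Proof.
rewrite mnmDE mnm1E addn_eq0 negb_and (inj_eq enum_rank_inj) [a == b]eq_sym.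
by case: (b == a).
Qed.

(** One factor after the other is replaced by its meet with the current least
    factor, while the join joins the remaining factors. *)
Lemma straight_min m : m != 0%MM ->
  exists a m1, straight_equiv m (var a + m1)%MM /\
               forall b, m1 (enum_rank b) != 0%N -> (a <= b)%O.
Proof.
have [k] := ubnP (mdeg m); elim: k m => // k IH m mk /mnm_neq0[i mi].
have mE := var_dvd mi; rewrite -(enum_valK i) in mE.
set b := enum_val i in mE; set m0 := (m - _)%MM in mE.
have [m00|/IH[|a [m1 [m0m1 a_min]]]] := eqVneq m0 0%MM.
- exists b, 0%MM; rewrite {1}mE m00; split; first exact: straight_refl.
  by move=> c; rewrite mnm0E.
- by move: mk; rewrite mE mdegD mdeg1.
exists (Order.meet b a), (var (Order.join b a) + m1)%MM; split.
  rewrite mE; apply: straight_trans (straight_add _ m0m1) _.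
  rewrite !addmA ![(_ + m1)%MM]addmC.
  exact/straight_add/straight_relation.
move=> c; rewrite mem_varD => /predU1P[->|/a_min].
  exact: le_trans (leIl _ _) (leUl _ _).
exact: le_trans (leIr _ _).
Qed.

Lemma im_eq0 m : im m = 0%MM -> m = 0%MM.
Proof.
case: eP => _ e0 _ m0; apply/eqP; apply: contraTT isT => /mnm_neq0[i mi].
have := e0 (enum_val i); rewrite -mnm_imageU enum_valK.
have := m0; rewrite {1}(var_dvd mi) mnm_imageD => /eqP.
by rewrite mnmD_eq0 => /andP[->].
Qed.

(** After straightening both monomials have a least factor.  Each of these is a
    lower bound of the other monomial, hence they agree and can be cancelled. *)
Lemma im_straight m m' : im m = im m' -> straight_equiv m m'.
Proof.
have [k] := ubnP (mdeg m); elim: k m m' => // k IH m m' mk eq_im.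
have [m0|m0] := eqVneq m 0%MM.
  by rewrite (@im_eq0 m') -?eq_im m0 ?mnm_image0 //; apply: straight_refl.
have m'0 : m' != 0%MM.
  by apply: contra_neq m0 => m'0; apply: im_eq0; rewrite eq_im m'0 mnm_image0.
have [a [m1 [mm1 a_min]]] := straight_min m0.
have [a' [m1' [mm1' a'_min]]] := straight_min m'0.
have eq_im1 : im (var a + m1)%MM = im (var a' + m1')%MM.
  by case: mm1 mm1' => _ <- _ [_ <- _].
have min b m2 : (forall c, m2 (enum_rank c) != 0%N -> (b <= c)%O) ->
    forall c, (var b + m2)%MM (enum_rank c) != 0%N -> (b <= c)%O.
  by move=> b_min c; rewrite mem_varD => /predU1P[->|/b_min].
have aa' : a = a'.
  have [_ _ lowP] := eP; apply/eqP; rewrite eq_le.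
  rewrite (lowP _ _ _ eq_im1) ?mem_varD ?eqxx //=; last exact: min.
  rewrite (lowP _ _ _ (esym eq_im1)) ?mem_varD ?eqxx //=; exact: min.
apply: straight_trans (mm1) (straight_trans _ (straight_sym mm1')).
rewrite -aa'; apply/straight_add/IH.
  by case: mm1 mk => _ _ ->; rewrite mdegD mdeg1.
by move: eq_im1; rewrite -aa' !mnm_imageD => /addmI.
Qed.

(** A nonzero element of the kernel has two monomials in the same fibre.  Their
    difference lies in the Hibi ideal, and subtracting a multiple of it shortens
    the element. *)
Lemma toric_eq0 p : toric p = 0 <-> hibi_pi p = 0 :> hibi_ring K M.
Proof.
split; last first.
  case/hibi_pi_eq0 => k [c [g [gP ->]]]; rewrite raddf_sum big1 //= => i _.
  have [a [b ->]] := gP i; rewrite rmorphM rmorphB !rmorphM /=.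
  rewrite !toricX !mnm_imageU -!mpolyXD; case: eP => -> _ _.
  by rewrite subrr mulr0.
have [k] := ubnP (size (msupp p)); elim: k p => // k IH p pk p0.
have [->|pn0] := eqVneq p 0; first exact: raddf0.
have [m mp] : exists m, m \in msupp p.
  by exists (mlead p); apply: mlead_supp.
have [m' [m'p m'm eq_im]] : exists m', [/\ m' \in msupp p, m' != m & im m' = im m].
  apply: contrapT => no; move: (mp); rewrite mcoeff_msupp => /eqP; apply.
  have := mcoeff_toric e p (im m); rewrite p0 mcoeff0 => ->.
  rewrite big_mkcond (bigD1_seq m) ?msupp_uniq //= eqxx big1_seq ?addr0 //.
  by move=> m' /andP[m'm m'p]; case: eqP => // im'; case: no; exists m'.
pose q := p - p@_m *: ('X_[m] - 'X_[m']).
have eq_pi : hibi_pi ('X_[m] - 'X_[m']) = 0 :> hibi_ring K M.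
  by have [e1 _ _] := im_straight eq_im; rewrite raddfB /= e1 subrr.
have -> : hibi_pi p = hibi_pi q :> hibi_ring K M.
  by rewrite raddfB /= hibi_piZ eq_pi scaler0 subr0.
have coefq m2 : q@_m2 = p@_m2 - p@_m * ((m == m2)%:R - (m' == m2)%:R).
  by rewrite mcoeffB mcoeffZ mcoeffB !mcoeffX.
apply: IH; last first.
  by rewrite comp_mpolyB p0 comp_mpolyZ comp_mpolyB !toricX eq_im subrr scaler0 subr0.
rewrite -ltnS; apply: leq_trans pk; rewrite ltnS.
apply: (@leq_ltn_trans (size (rem m (msupp p)))); last first.
  by rewrite size_rem // prednK //; case: (msupp p) mp.
apply: uniq_leq_size (msupp_uniq q) _ => m2; rewrite mem_rem_uniq ?msupp_uniq //.
rewrite inE /= !mcoeff_msupp coefq; have [->|m2m] := eqVneq m2 m.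
  by rewrite (negPf m'm) subr0 mulr1 subrr eqxx.
rewrite sub0r; case: (m' =P m2) => [<- _|_]; first by rewrite -mcoeff_msupp.
by rewrite oppr0 mulr0 subr0.
Qed.

End HibiExponents.

(** * The Gröbner basis of Hibi relations *)

Section DegRevLex.
Variables (n : nat) (σ : 'S_n).
Implicit Types m : 'X_{1..n}.

Lemma drl_lt_asym m m' : drl_lt σ m m' -> drl_lt σ m' m -> False.
Proof.
rewrite /drl_lt; case: ltngtP => //= _ /existsP[i /andP[lt_i after_i]].
case/existsP=> j /andP[lt_j after_j]; case: (ltngtP i j) => ij.
- by move: lt_j; rewrite (eqP (implyP (forallP after_i j) ij)) ltnn.
- by move: lt_i; rewrite (eqP (implyP (forallP after_j i) ij)) ltnn.
by move: lt_i lt_j; rewrite (val_inj ij) => /ltn_trans lt /lt; rewrite ltnn.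
Qed.

Lemma drl_lt_add2l m0 m m' : drl_lt σ (m0 + m)%MM (m0 + m')%MM = drl_lt σ m m'.
Proof.
rewrite /drl_lt !mdegD ltn_add2l eqn_add2l; congr (_ || _ && _).
apply: eq_existsb => i; rewrite !mnmDE ltn_add2l; congr (_ && _).
by apply: eq_forallb => j; rewrite !mnmDE eqn_add2l.
Qed.

End DegRevLex.

Section HibiGroebner.
Variables (K : fieldType) (d : Order.disp_t) (M : finTBDistrLatticeType d).
Variables (s : nat) (e : M -> 'X_{1..s}).
Hypothesis eP : hibi_exponents e.
Notation n := #|M|.
Notation var a := (U_(enum_rank a)%MM : 'X_{1..n}).
Notation toric p := (p \mPo monomial_tuple K e).
Notation im := (mnm_image e).
Implicit Types (m : 'X_{1..n}) (a b c : M) (p : {mpoly K[n]}).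

Lemma toric_quadratically_generated :
  quadratically_generated (fun p : {mpoly K[n]} => toric p = 0).
Proof.
exists (@hibi_relation K d M); split=> [_ [a [b ->]]|p].
  by rewrite rpredB // -mpolyXD dhomogX /= mdegD !mdeg1.
by rewrite (toric_eq0 eP) hibi_pi_eq0.
Qed.

(** The order of the variables extends the order of the lattice: the variable
    of index σ i decreases with i. *)
Definition antitone_perm (σ : 'S_n) :=
  forall i j, (enum_val (σ i) < enum_val (σ j))%O -> (j < i)%N.

Lemma antitone_perm_exists : exists σ, antitone_perm σ.
Proof.
have [w wM w_pw] := linear_extension M.
have size_w : size w = n by rewrite (perm_size wM) cardE.
have uniq_w : uniq w by rewrite (perm_uniq wM) enum_uniq.
pose f (i : 'I_n) : 'I_n := enum_rank (nth \bot%O w i).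
have f_inj : injective f.
  move=> i j /enum_rank_inj/eqP.
  by rewrite nth_uniq ?size_w // => /eqP/val_inj.
exists (perm f_inj) => i j; rewrite !permE /f !enum_rankK => lt_ij.
rewrite ltnNge leq_eqVlt; apply/negP => /orP[/eqP ij|ij].
  by move: lt_ij; rewrite ij ltxx.
have /(pairwiseP \bot%O)/(_ i j) := w_pw.
by rewrite !inE size_w !ltn_ord ij => /(_ isT isT isT)/negP.
Qed.

Definition standard m := forall a b,
  m (enum_rank a) != 0%N -> m (enum_rank b) != 0%N -> (a >=< b)%O.

Variable σ : 'S_n.
Hypothesis σP : antitone_perm σ.

(** The standard monomial of a fibre is its smallest monomial: its least
    factor a is a lower bound of every factor of the others, so that either a
    can be cancelled or a is a smaller variable than all those of the others. *)
Lemma standard_drl_lt m m' : standard m -> im m = im m' -> m != m' ->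
  drl_lt σ m m'.
Proof.
have [k] := ubnP (mdeg m); elim: k m m' => // k IH m m' mk m_std eq_im neq.
have m0 : m != 0%MM.
  apply: contraNneq neq => m0; rewrite m0; apply/eqP/esym/(im_eq0 eP).
  by rewrite -eq_im m0 mnm_image0.
have [i0 i0P] := mnm_neq0 m0.
rewrite -(permKV σ i0) in i0P; move: ((σ^-1)%g i0) i0P => {}i0 i0P.
case: (@arg_maxnP _ i0 (fun i => m (σ i) != 0%N) (fun i => i) i0P) => i mi maxi.
pose a := enum_val (σ i); have ra : enum_rank a = σ i by rewrite enum_valK.
have pos b : exists j, enum_rank b = σ j /\ b = enum_val (σ j).
  by exists ((σ^-1)%g (enum_rank b)); rewrite permKV enum_rankK.
have a_min b : m (enum_rank b) != 0%N -> (a <= b)%O.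
  move=> mb; have := m_std a b; rewrite ra => /(_ mi mb); case: comparableP => // ba _.
  have [j [rb bE]] := pos b; have := σP; move/(_ j i); rewrite -bE => /(_ ba).
  by have := maxi j; rewrite -rb => /(_ mb) /=; rewrite leqNgt => /negP.
have ma : m (enum_rank a) != 0%N by rewrite ra.
have a_min' : forall b, m' (enum_rank b) != 0%N -> (a <= b)%O.
  by case: eP => _ _; apply; [exact: eq_im | exact: ma | exact: a_min].
have [m'a|m'a] := eqVneq (m' (enum_rank a)) 0%N; last first.
  rewrite (var_dvd ma) (var_dvd m'a) drl_lt_add2l; apply: IH.
  - by move: mk; rewrite {1}(var_dvd ma) mdegD mdeg1.
  - move=> b c mb mc; apply: m_std; rewrite (var_dvd ma) mem_varD ?mb ?mc orbT //.
  - apply: (@addmI _ (e a)); rewrite -mnm_imageU -!mnm_imageD.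
    by rewrite -(var_dvd ma) -(var_dvd m'a).
  by apply: contra_neq neq => eqm; rewrite (var_dvd ma) (var_dvd m'a) eqm.
have [_ _ eq_deg] := @im_straight K _ _ _ _ eP _ _ eq_im.
rewrite /drl_lt eq_deg eqxx ltnn /=; apply/existsP; exists i.
rewrite -ra m'a lt0n ma /=; apply/forallP => j; apply/implyP => ij.
have -> : m (σ j) = 0%N.
  by apply: contraTeq ij => /maxi; rewrite -leqNgt.
rewrite eq_sym; apply: contraTT ij => m'j; rewrite -leqNgt leq_eqVlt.
have := a_min' (enum_val (σ j)); rewrite enum_valK => /(_ m'j).
rewrite le_eqVlt => /orP[/eqP aj|/σP-> //]; last by rewrite orbT.
by move: m'j; rewrite -[σ j]enum_valK -aj m'a.
Qed.

(** The initial monomials of the Hibi relations of incomparable pairs are the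
    products of these pairs.  A leading monomial of the kernel is not minimal in
    its fibre, hence not standard, and so it is divisible by such a product. *)
Lemma toric_has_quadratic_gb :
  has_quadratic_drl_gb (fun p : {mpoly K[n]} => toric p = 0).
Proof.
pose rel (ab : M * M) : {mpoly K[n]} :=
  'X_(enum_rank ab.1) * 'X_(enum_rank ab.2)
  - 'X_(enum_rank (Order.meet ab.1 ab.2)) * 'X_(enum_rank (Order.join ab.1 ab.2)).
pose G := [seq rel ab | ab <- enum {: M * M} & ~~ (ab.1 >=< ab.2)%O].
pose u a b := (var a + var b)%MM.
pose v a b := (var (Order.meet a b) + var (Order.join a b))%MM.
have relE a b : rel (a, b) = 'X_[u a b] - 'X_[v a b] by rewrite /rel !mpolyXD.
have GP g : g \in G -> exists a b, ~~ (a >=< b)%O /\ g = rel (a, b).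
  by case/mapP => -[a b]; rewrite mem_filter => /andP[? _] ->; exists a, b.
have memG a b : ~~ (a >=< b)%O -> rel (a, b) \in G.
  by move=> ab; apply/mapP; exists (a, b); rewrite // mem_filter ab mem_enum.
have mem_var2 a b c : ((var a + var b)%MM (enum_rank c) != 0%N) = (c == a) || (c == b).
  by rewrite mem_varD mnm1E (inj_eq enum_rank_inj) eqb0 negbK [b == c]eq_sym.
have rel_ker a b : toric (rel (a, b)) = 0.
  by apply/(toric_eq0 eP)/hibi_pi_eq0/mem_ideal_gen; exists a, b.
have uv_im a b : im (v a b) = im (u a b).
  by case: eP => mod_e _ _; rewrite !mnm_imageD !mnm_imageU -mod_e.
have uv_neq a b : ~~ (a >=< b)%O -> v a b != u a b.
  apply: contraNneq => /(congr1 (fun m : 'X_{1..n} => m (enum_rank a) != 0%N)).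
  rewrite !mem_var2 eqxx orTb => /pred2P[] aE.
    by rewrite [X in (X >=< _)%O]aE le_comparable ?leIr.
  by rewrite comparable_sym [X in (_ >=< X)%O]aE le_comparable ?leUr.
have uv_lt a b : ~~ (a >=< b)%O -> drl_lt σ (v a b) (u a b).
  move=> ab; apply: standard_drl_lt; [|exact: uv_im|exact: uv_neq].
  have lo : (Order.meet a b <= Order.join a b)%O := le_trans (leIl _ _) (leUl _ _).
  move=> x y; rewrite !mem_var2 => /pred2P[]-> /pred2P[]->;
    by rewrite ?comparablexx ?(le_comparable lo) // comparable_sym le_comparable.
have rel_init a b : ~~ (a >=< b)%O -> is_initial (drl_lt σ) (rel (a, b)) (u a b).
  move=> ab; have coefE m : (rel (a, b))@_m = (u a b == m)%:R - (v a b == m)%:R.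
    by rewrite relE mcoeffB !mcoeffX.
  split=> [|m].
    by rewrite mcoeff_msupp coefE eqxx (negPf (uv_neq _ _ ab)) subr0 oner_eq0.
  rewrite mcoeff_msupp coefE => + /negPf; rewrite [m == _]eq_sym => + um.
  by rewrite um; case: (v a b =P m) => [<- _|]; [exact: uv_lt | rewrite subrr eqxx].
exists σ, G; split; last first.
  move=> _ /GP[a [b [_ ->]]]; rewrite /rel rpredB // -mpolyXD dhomogX /=;
  by rewrite mdegD !mdeg1.
split=> [_ /GP[a [b [ab ->]]]|q].
  split; first exact: rel_ker.
  by apply: contraTneq (rel_init _ _ ab).1 => ->; rewrite msupp0.
split; last first.
  apply: ideal_gen_trans => _ [p [m [pG pm ->]]]; apply: mem_ideal_gen.
  by exists p, m; split=> //; have [a [b [_ ->]]] := GP p pG; apply: rel_ker.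
apply: ideal_gen_trans => _ [p [m [p0 [mp m_init] ->]]].
have [a [b [ma mb ab]]] : exists a b,
    [/\ m (enum_rank a) != 0%N, m (enum_rank b) != 0%N & ~~ (a >=< b)%O].
  apply: contrapT => no; have m_std : standard m.
    by move=> a b ma mb; apply: contrapT => /negP ab; apply: no; exists a, b.
  suff : p@_m = 0 by move: mp; rewrite mcoeff_msupp => /eqP.
  have := mcoeff_toric e p (im m); rewrite p0 mcoeff0 => ->.
  rewrite big_mkcond (bigD1_seq m) ?msupp_uniq //= eqxx big1_seq ?addr0 //.
  move=> m' /andP[m'm m'p]; case: eqP => // im'.
  case: (@drl_lt_asym _ σ m m'); last exact: m_init.
  by apply: standard_drl_lt; rewrite // eq_sym.
have neq_ab : a != b by apply: contraNneq ab => ->; apply: comparablexx.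
have mE : m = (m - var a - var b + u a b)%MM.
  rewrite [u a b]addmC addmA submK; last first.
    apply/mnm_lepP => i; rewrite mnm1E mnmBE mnm1E; case: eqP => // <-.
    by rewrite (inj_eq enum_rank_inj) (negPf neq_ab) subn0 lt0n.
  rewrite submK //; apply/mnm_lepP => i; rewrite mnm1E.
  by case: eqP => // <-; rewrite lt0n.
rewrite mE mpolyXD; apply/ideal_genM/mem_ideal_gen; exists (rel (a, b)), (u a b).
by split=> //; [exact: memG | exact: rel_init].
Qed.

End HibiGroebner.

(** * Hibi rings are Koszul *)

Section JoinPrime.
Variables (d : Order.disp_t) (M : finTBDistrLatticeType d).
Implicit Types a b p q : M.

(** The bottom element counts as join-prime: in the exponents below, its
    coordinate records the degree. *)
Definition join_prime p : bool :=
  [forall a, forall b, (p <= Order.join a b)%O ==> (p <= a)%O || (p <= b)%O].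

Lemma join_primeU p a b :
  join_prime p -> (p <= Order.join a b)%O = (p <= a)%O || (p <= b)%O.
Proof.
move=> /forallP/(_ a)/forallP/(_ b)/implyP pP; apply/idP/idP => // /orP[]/le_trans; apply.
  exact: leUl.
exact: leUr.
Qed.

(** A minimal element among those below a but not below b is join-prime: a
    strictly smaller element that is below a is also below b. *)
Lemma join_prime_separation a b : ~~ (a <= b)%O ->
  exists p, [/\ join_prime p, (p <= a)%O & ~~ (p <= b)%O].
Proof.
move=> ab; have aP : (a <= a)%O && ~~ (a <= b)%O by rewrite lexx.
case: (@arg_minnP _ a (fun p => (p <= a)%O && ~~ (p <= b)%O)
  (fun p => #|[set q | (q < p)%O]|) aP) => p /andP[pa pb] p_min.
exists p; split=> //.
have below q : (q < p)%O -> (q <= b)%O.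
  move=> qp; apply: contraTT isT => qb.
  have : (#|[set r | (r < p)%O]| <= #|[set r | (r < q)%O]|)%N.
    by apply: p_min; rewrite qb (le_trans (ltW qp)).
  rewrite leqNgt => /negP[]; apply: proper_card; apply/properP; split.
    by apply/subsetP => r; rewrite !inE => /lt_trans; apply.
  by exists q; rewrite !inE ?ltxx.
apply/forallP => x; apply/forallP => y; apply/implyP => pxy.
apply: contraNT pb; rewrite negb_or => /andP[px py].
have lt_meet z : ~~ (p <= z)%O -> (Order.meet p z <= b)%O.
  by move=> pz; apply: below; rewrite lt_neqAle leIl andbT eq_meetl.
have -> : p = Order.join (Order.meet p x) (Order.meet p y).
  by rewrite -meetUr; apply/esym/eqP; rewrite eq_meetl.
by rewrite leUx !lt_meet.
Qed.

(** Join-primeness makes these exponents modular. *)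
Definition join_prime_exponent a : 'X_{1..#|M|} :=
  (\sum_(p | join_prime p && (p <= a)%O) U_(enum_rank p))%MM.

Lemma join_prime_exponentE a p :
  join_prime_exponent a (enum_rank p) = (join_prime p && (p <= a)%O).
Proof.
rewrite mnm_sumE; under eq_bigr do rewrite mnm1E (inj_eq enum_rank_inj).
have [pa|/negPf pa] := boolP (_ && _).
  by rewrite (bigD1 p) //= eqxx big1 // => q /andP[_ /negPf->].
by apply: big1 => q qa; case: eqP => // qp; rewrite qp pa in qa.
Qed.

Lemma join_prime_bot : join_prime \bot%O.
Proof. by apply/forallP => a; apply/forallP => b; rewrite !le0x. Qed.

Lemma mdeg_join_prime (m : 'X_{1..#|M|}) :
  mdeg m = mnm_image join_prime_exponent m (enum_rank (\bot%O : M)).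
Proof.
rewrite mnm_imageE mdegE; apply: eq_bigr => i _.
by rewrite join_prime_exponentE join_prime_bot le0x mul1n.
Qed.

Lemma join_prime_exponentP : hibi_exponents join_prime_exponent.
Proof.
split=> [a b|a|m m' a eq_im ma a_min b m'b].
- apply/mnmP => i; rewrite -(enum_valK i) !mnmDE !join_prime_exponentE.
  have [pP|] := boolP (join_prime _); rewrite //= lexI join_primeU //.
  by case: (_ <= a)%O; case: (_ <= b)%O.
- apply/eqP => /(congr1 (fun m : 'X_{1..#|M|} => m (enum_rank (\bot%O : M)))).
  by rewrite join_prime_exponentE join_prime_bot le0x mnm0E.
apply: contraT => /join_prime_separation[p [pP pa pb]].
have eq_deg : mdeg m = mdeg m' by rewrite !mdeg_join_prime eq_im.
have : mnm_image join_prime_exponent m' (enum_rank p) = mdeg m'.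
  rewrite -eq_im -eq_deg mnm_imageE mdegE; apply: eq_bigr => i _.
  rewrite join_prime_exponentE pP; have [->|mi] := eqVneq (m i) 0%N.
    by rewrite muln0.
  by rewrite (le_trans pa) ?mul1n // a_min // enum_valK.
rewrite mnm_imageE mdegE (bigD1 (enum_rank b)) //= [RHS](bigD1 (enum_rank b)) //=.
rewrite join_prime_exponentE enum_rankK pP (negPf pb) mul0n add0n.
have : (\sum_(i < #|M| | i != enum_rank b)
   join_prime_exponent (enum_val i) (enum_rank p) * m' i <=
   \sum_(i < #|M| | i != enum_rank b) m' i)%N.
  apply: leq_sum => i _; rewrite join_prime_exponentE.
  by case: (_ && _); rewrite ?mul1n ?mul0n.
move=> + eq_sum; rewrite eq_sum -[X in (_ <= X)%N]add0n leq_add2r leqn0.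
by rewrite (negPf m'b).
Qed.

End JoinPrime.

Section HibiKoszul.
Variables (K : fieldType) (d : Order.disp_t) (M : finTBDistrLatticeType d).
Notation n := #|M|.
Notation P := {mpoly K[n]}.
Notation A := (hibi_ring K M).
Notation e := (@join_prime_exponent d M).
Notation toric p := (p \mPo monomial_tuple K e).
Let eP := join_prime_exponentP M.
Implicit Types (p q : P) (a b c : M) (f : A) (m : 'X_{1..n}).

Definition hibi_var a : A := hibi_pi 'X_(enum_rank a).

(** Homogeneous components are well defined on the Hibi ring because all
    monomials of a fibre have the same degree. *)
Lemma hibi_pi_pihomog k p :
  hibi_pi p = 0 :> A -> hibi_pi (pihomog mdeg k p) = 0 :> A.
Proof.
move=> /(toric_eq0 eP) p0; apply/(toric_eq0 eP)/mpolyP => v.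
rewrite pihomogE (raddf_sum (comp_mpoly _)) raddf_sum /= mcoeff0.
have toric_coef m : (toric (p@_m *: 'X_[m]))@_v = (mnm_image e m == v)%:R * p@_m.
  by rewrite comp_mpolyZ toricX mcoeffZ mcoeffX mulrC.
under eq_bigr do rewrite toric_coef.
have := mcoeff_toric e p v; rewrite p0 mcoeff0 big_mkcond /= => sum0.
have [vk|vk] := eqVneq (v (enum_rank (\bot%O : M))) k; last first.
  apply: big1 => m /eqP mk; case: eqP; rewrite ?mul0r // => mv.
  by move: vk; rewrite -mv -mdeg_join_prime mk eqxx.
rewrite [RHS]sum0 big_mkcond /=; apply: eq_bigr => m _.
case: (mnm_image e m =P v) => [mv|_]; last by rewrite mul0r if_same.
by rewrite mul1r ifT // mdeg_join_prime mv vk.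
Qed.

Definition hibi_component k f : A := hibi_pi (pihomog mdeg k (generic_quotient.repr f)).

Lemma hibi_componentE k p : hibi_component k (hibi_pi p) = hibi_pi (pihomog mdeg k p).
Proof.
apply/eqP; rewrite -subr_eq0 -raddfB -pihomogB; apply/eqP/hibi_pi_pihomog.
by rewrite raddfB /= [hibi_pi (generic_quotient.repr _)]generic_quotient.reprK subrr.
Qed.

Lemma hibi_component_additive k : additive (hibi_component k).
Proof.
move=> f g; have [p ->] := hibi_pi_surj f; have [q ->] := hibi_pi_surj g.
by rewrite -raddfB !hibi_componentE pihomogB raddfB.
Qed.

HB.instance Definition _ k :=
  GRing.isAdditive.Build A A (hibi_component k) (@hibi_component_additive k).

Lemma pihomogM1 k p q : q \is 1.-homog ->
  pihomog mdeg k.+1 (p * q) = pihomog mdeg k p * q.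
Proof.
move=> q1; have pE := pihomog_partitionE (leqnn (mmeasure mdeg p)).
have kE : pihomog mdeg k p = \sum_(j < mmeasure mdeg p) pihomog mdeg k (pihomog mdeg j p).
  by rewrite {1}pE raddf_sum.
rewrite kE {1}pE !mulr_suml raddf_sum /=; apply: eq_bigr => j _.
have pq_homog : pihomog mdeg j p * q \is (j.+1).-homog.
  by rewrite -addn1; apply: dhomogM => //; apply: pihomogP.
have [jk|jk] := eqVneq (j : nat) k.
  by rewrite -jk (pihomog_dE pq_homog) pihomog_id.
by rewrite (pihomog_ne0 _ pq_homog) // (pihomog_ne0 jk (pihomogP _ _ _)) mul0r.
Qed.

Lemma hibi_projections :
  linear_projections (@hibi_grading K d M 1) (hibi_component 1)
    (GRing.Additive.clone _ _ (hibi_component 2) _).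
Proof.
split=> [f|f [p [p1 ->]]|f g [q [q1 ->]]] /=.
- by exists (pihomog mdeg 1 (generic_quotient.repr f)); split=> //; apply: pihomogP.
- by rewrite hibi_componentE pihomog_dE.
have [p ->] := hibi_pi_surj f.
by rewrite -rmorphM !hibi_componentE pihomogM1 // rmorphM.
Qed.

(** The retraction that keeps the variables of the filter above a. *)
Definition filter_tuple a :=
  [tuple (if (a <= enum_val i)%O then 'X_i else 0 : P) | i < n].
Notation restrict a p := (p \mPo filter_tuple a).

Lemma restrict_var a b :
  restrict a ('X_(enum_rank b)) = if (a <= b)%O then 'X_(enum_rank b) else 0.
Proof. by rewrite comp_mpolyXU -tnth_nth tnth_mktuple enum_rankK. Qed.

(** It is compatible with the Hibi relations because a meet lies above a only
    if both factors do. *)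
Lemma restrict_hibi a p : hibi_pi p = 0 :> A -> hibi_pi (restrict a p) = 0 :> A.
Proof.
case/hibi_pi_eq0 => k [c [g [gP ->]]].
rewrite (raddf_sum (comp_mpoly _)) raddf_sum big1 //= => i _; have [x [y ->]] := gP i.
rewrite rmorphM [hibi_pi _]rmorphM rmorphB !rmorphM /= !restrict_var lexI.
have [ax|ax] := boolP (a <= x)%O; have [ay|ay] := boolP (a <= y)%O; rewrite /=;
  rewrite ?mul0r ?mulr0 ?subr0 ?raddf0 ?mulr0 //.
rewrite (le_trans ax (leUl _ _)) [X in _ * X]((hibi_pi_eq0 _).2) ?mulr0 //.
by apply: mem_ideal_gen; exists x, y.
Qed.

Lemma restrict_mod a (w : seq M) p : (forall b, ~~ (a <= b)%O -> b \in w) ->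
  lspan (map hibi_var w : seq A^o) (hibi_pi (p - restrict a p)).
Proof.
move=> wP; have -> : p - restrict a p =
    \sum_(m <- msupp p) p@_m *: ('X_[m] - restrict a 'X_[m]).
  rewrite {1}[p]mpolyE comp_mpolyEX -sumrB.
  by apply: eq_bigr => m _; rewrite scalerBr.
rewrite raddf_sum /=; apply: lspan_sum => m _; rewrite -mul_mpolyC rmorphM /=.
apply: (@lspanZ _ A^o); have [/existsP[i /andP[mi ai]]|] :=
  boolP [exists i, (m i != 0%N) && ~~ (a <= enum_val i)%O].
  have [b iE] : exists b, i = enum_rank b by exists (enum_val i); rewrite enum_valK.
  rewrite iE enum_rankK in mi ai.
  rewrite (var_dvd mi) mpolyXD [restrict a _]rmorphM /= restrict_var (negPf ai).
  rewrite mul0r subr0 mulrC rmorphM; apply: (@lspanZ _ A^o); apply: lspan_mem.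
  exact/map_f/wP.
rewrite negb_exists => /forallP m_above; rewrite comp_mpolyX [X in X - _]mpolyXE_id.
rewrite [X in _ - X](_ : _ = \prod_(i < n) 'X_i ^+ m i) ?subrr ?raddf0; last first.
  apply: eq_bigr => i _; rewrite tnth_mktuple.
  have := m_above i; rewrite negb_and !negbK => /orP[/eqP->|->]; by rewrite ?expr0.
exact: (@lspan0 _ A^o).
Qed.

(** The colon ideal that makes poset ideals a Koszul filtration.  If b is not
    above a, then x_b x_a is a multiple of the variable of the meet of a and b,
    which is strictly below a.  Conversely, if f x_a lies in the ideal of E,
    the retraction onto the filter above a maps f x_a to zero; as the Hibi ring
    is a domain, it maps f to zero, so that f is a combination of the variables
    that it kills. *)
Lemma hibi_colon a (E w : seq M) f :
    (forall b, (b < a)%O -> b \in E) -> (forall b, b \in E -> ~~ (a <= b)%O) ->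
    (forall b, (b \in w) = ~~ (a <= b)%O) ->
  lspan (map hibi_var E : seq A^o) (f * hibi_var a) <->
  lspan (map hibi_var w : seq A^o) f.
Proof.
move=> below_E E_above wE; split=> [fE|].
  have [p f_p] := hibi_pi_surj f.
  have /= [q [q_f q0]] : exists q, f * hibi_var a = hibi_pi q /\ restrict a q = 0.
    pose Q (g : A^o) := exists q, g = hibi_pi q /\ restrict a q = 0.
    apply: (@lspan_ind _ _ Q _ _ _ _ fE); first by exists 0; rewrite !raddf0.
    move=> g _ _ [q [-> q0]] /mapP[b bE ->]; have [r ->] := hibi_pi_surj g.
    exists (r * 'X_(enum_rank b) + q); rewrite raddfD /= rmorphM; split=> //.
    by rewrite comp_mpolyD q0 addr0 rmorphM /= restrict_var (negPf (E_above b bE)) mulr0.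
  have : hibi_pi (restrict a (p * 'X_(enum_rank a) - q)) = 0 :> A.
    by apply: restrict_hibi; rewrite raddfB /= -q_f rmorphM f_p subrr.
  rewrite raddfB /= q0 subr0 rmorphM /= restrict_var lexx => /(toric_eq0 eP).
  rewrite rmorphM /= => /eqP; rewrite mulf_eq0 toricX.
  have -> : ('X_[mnm_image e U_(enum_rank a)] == 0 :> P) = false.
    by apply/eqP => /(congr1 (@msupp _ _)); rewrite msuppX msupp0.
  rewrite orbF => /eqP/(toric_eq0 eP) rp0.
  rewrite f_p -[hibi_pi p]subr0 -rp0 -raddfB; apply: restrict_mod => b.
  by rewrite wE.
move=> fw; apply: (@lspan_ind _ A^o (fun g => lspan _ (g * hibi_var a)) _ _ _ _ fw).
  by rewrite mul0r; apply: (@lspan0 _ A^o).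
move=> g _ h hE /mapP[b + ->]; rewrite wE => ab; rewrite mulrDl.
apply: (@lspanD _ A^o) => //; rewrite -[_ *: _]/(g * _) -mulrA.
apply: (@lspanZ _ A^o).
have -> : hibi_var b * hibi_var a =
    hibi_var (Order.join a b) * hibi_var (Order.meet a b).
  rewrite /hibi_var -!rmorphM; apply/eqP; rewrite -subr_eq0 -raddfB.
  apply/eqP/hibi_pi_eq0/mem_ideal_gen; exists a, b.
  by rewrite mulrC [X in _ - X]mulrC.
apply: (@lspanZ _ A^o); apply/lspan_mem/map_f/below_E.
by rewrite lt_neqAle leIl andbT eq_meetl.
Qed.

Lemma hibi_irrelevant (w : seq M) f : (forall a, a \in w) ->
  irrelevant_ideal (@hibi_grading K d M) f <-> lspan (map hibi_var w : seq A^o) f.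
Proof.
move=> wP; have grP k p : p \is k.-homog -> hibi_grading k (hibi_pi p : A).
  by exists p.
have irrP p : p@_0 = 0 -> irrelevant_ideal (@hibi_grading K d M) (hibi_pi p).
  move=> p0; exists (mmeasure mdeg p), (fun k => hibi_pi (pihomog mdeg k.+1 p)).
  split=> [k|]; first exact/grP/pihomogP.
  have le_p := leqnSn (mmeasure mdeg p).
  rewrite {1}(pihomog_partitionE le_p) big_ord_recl [X in X + _](_ : _ = 0).
    by rewrite add0r raddf_sum.
  rewrite pihomogE; apply: big1 => m; rewrite mdeg_eq0 => /eqP->.
  by rewrite p0 scale0r.
split=> [[k [y [yP ->]]]|fw].
  apply: lspan_sum => i _; have [p [p_homog ->]] := yP i.
  rewrite [p in hibi_pi p]mpolyE raddf_sum; apply: lspan_sum => m _.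
  have [mp|/memN_msupp_eq0->] := boolP (m \in msupp p); last first.
    by rewrite scale0r raddf0; apply: (@lspan0 _ A^o).
  have := dhomog_mf p_homog mp; move=> /= m_deg.
  have /mnm_neq0[j mj] : m != 0%MM by rewrite -mdeg_eq0 m_deg.
  rewrite (var_dvd mj) addmC mpolyXD scalerAl rmorphM.
  apply: (@lspanZ _ A^o); apply: lspan_mem.
  by rewrite -(enum_valK j); apply/map_f/wP.
have /= [p [-> /irrP]] // : exists p, f = hibi_pi p /\ p@_0 = 0.
pose Q (g : A^o) := exists p, g = hibi_pi p /\ p@_0 = 0.
apply: (@lspan_ind _ _ Q _ _ _ _ fw); first by exists 0; rewrite raddf0 mcoeff0.
move=> g _ _ [q [-> q0]] /mapP[b _ ->]; have [r ->] := hibi_pi_surj g.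
exists (r * 'X_(enum_rank b) + q); rewrite raddfD /= rmorphM; split=> //.
rewrite mcoeffD q0 addr0 (rmorphM (mcoeff 0%MM)) /= mcoeffX.
by rewrite mnm1_eq0 mulr0.
Qed.

(** The filtration consists of the ideal of all variables and, for each a, the
    ideal of the variables not above a. *)
Theorem hibi_koszul : koszul (@hibi_grading K d M).
Proof.
have [w0 w0M w0_pw] := linear_extension M.
have w0P a : a \in w0 by rewrite (perm_mem w0M) mem_enum.
have w0_uniq : uniq w0 by rewrite (perm_uniq w0M) enum_uniq.
pose S a := [seq b <- w0 | ~~ (a <= b)%O].
pose F (w : seq A) := w = map hibi_var w0 \/ exists a, w = map hibi_var (S a).
have linear_map w : (forall b c, b \in w -> (c < b)%O -> c \in w) ->
    uniq w -> pairwise (fun a b => ~~ (a < b)%O) w ->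
    linear_quotients F (map hibi_var w : seq A^o).
  elim: w => //= a w IH w_down /andP[aw w_uniq] /andP[/allP a_top w_pw].
  have below b c : b \in a :: w -> (c < b)%O -> c \in w.
    move=> bw cb; have := w_down b c bw cb; rewrite inE => /predU1P[ca|//].
    move: bw; rewrite inE -ca => /predU1P[bc|/a_top]; last by rewrite -ca cb.
    by move: cb; rewrite bc ltxx.
  split.
    by apply: IH => // b c bw; apply: below; rewrite inE bw orbT.
  exists (map hibi_var (S a)); first by right; exists a.
  move=> f; apply: hibi_colon => [b|b bw|b]; last by rewrite mem_filter w0P andbT.
    by apply: below; rewrite mem_head.
  have := a_top b bw; rewrite lt_neqAle negb_and negbK => /orP[/eqP ab|//].
  by move: aw; rewrite ab bw.
apply: (koszul_filtration hibi_projections (F := F) _ _ _ _ (w := map hibi_var w0)).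
- by exists 0; rewrite dhomog0 raddf0.
- by move=> f [p [p1 ->]]; exists (- p); rewrite dhomogN raddfN.
- move=> w Fw a; have [w' ->] : exists w', w = map hibi_var w'.
    by case: Fw => [->|[b ->]]; eexists.
  case/mapP => b _ ->; exists 'X_(enum_rank b); split=> //.
  by rewrite dhomogX /= mdeg1.
- move=> w [->|[a ->]]; apply: linear_map => //.
  + move=> b c; rewrite !mem_filter !w0P !andbT => ab cb.
    by apply: contra ab => /le_trans; apply; apply: ltW.
  + by rewrite filter_uniq.
  by apply: pairwise_filter.
- by left.
by move=> f; apply: hibi_irrelevant.
Qed.

End HibiKoszul.

(** * Planar distributive lattices *)

Section Chains.
Variables (d : Order.disp_t) (P : finPOrderType d).
Implicit Types (A B C : {set P}) (x y : P).

Lemma chainP C : reflect {in C &, forall x y, (x >=< y)%O} (chain C).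
Proof.
apply: (iffP forall_inP) => H x; last by move=> xC; apply/forall_inP => y; apply: H.
by move=> y xC; apply/forall_inP: y; apply: H.
Qed.

Lemma chain_set0 : chain (set0 : {set P}).
Proof. by apply/chainP => x y; rewrite inE. Qed.

Lemma chain_setU1 x C :
  chain C -> (forall y, y \in C -> (x >=< y)%O) -> chain (x |: C).
Proof.
move=> /chainP CP xC; apply/chainP => y z /setU1P[->|yC] /setU1P[->|zC].
- exact: comparablexx.
- exact: xC.
- by rewrite comparable_sym xC.
exact: CP.
Qed.

Lemma chainS A C : A \subset C -> chain C -> chain A.
Proof.
by move=> /subsetP AC /chainP CP; apply/chainP => x y /AC xC /AC yC; apply: CP.
Qed.

Lemma maxchain_mem C x :
  maxset (@chain d P) C -> (forall y, y \in C -> (x >=< y)%O) -> x \in C.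
Proof.
move=> /maxsetP[C_chain C_max] xC; rewrite -(C_max (x |: C)) ?setU11 ?subsetUr //.
exact: chain_setU1.
Qed.

(** Dilworth's theorem for width two, after Galvin.  Remove a maximal element a
    and cover the rest by two chains.  The largest element x of one of them
    that has an incomparable companion lies below a, since otherwise the
    largest elements of this kind and a form an antichain.  Then a together
    with the part of that chain below x is a chain, and what remains has no two
    incomparable elements. *)
Lemma two_chain_cover A :
    (forall B, B \subset A -> antichain B -> (#|B| <= 2)%N) ->
  exists C D, [/\ chain C, chain D & A = C :|: D].
Proof.
have [k] := ubnP #|A|; elim: k A => // k IH A Ak A2.
have [->|/set0Pn[a0 a0A]] := eqVneq A set0.
  by exists set0, set0; rewrite chain_set0 setU0.
case: (@arg_maxnP _ a0 (fun x => x \in A) (fun x => #|[set y | (y < x)%O]|) a0A).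
move=> a aA a_max {a0 a0A}.
have a_top x : x \in A -> ~~ (a < x)%O.
  move=> xA; apply/negP => ax; have := a_max x xA.
  rewrite /= leqNgt => /negP[]; apply: proper_card; apply/properP; split.
    by apply/subsetP => y; rewrite !inE => /lt_trans; apply.
  by exists a; rewrite !inE ?ltxx.
have [|B BA|C [D [C_chain D_chain AE]]] := IH (A :\ a).
- by move: Ak; rewrite (cardsD1 a) aA.
- by apply: A2; apply: subset_trans BA (subsetDl _ _).
pose T := [set x in A :\ a | [exists y in A :\ a, (x >< y)%O]].
have TP x y : x \in A :\ a -> y \in A :\ a -> (x >< y)%O -> x \in T.
  by move=> xA yA xy; rewrite inE xA; apply/existsP; exists y; rewrite yA.
(* Either chain of the cover may provide x, so C' and D' stand for C and D in
   some order. *)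
have reduce C' D' x : chain C' -> chain D' -> A :\ a = C' :|: D' -> x \in C' ->
    (forall z, z \in C' :&: T -> (z <= x)%O) -> (x < a)%O ->
  exists C D, [/\ chain C, chain D & A = C :|: D].
  move=> C'_chain D'_chain AE' xC' x_max xa.
  pose B := a |: [set z in C' | (z <= x)%O].
  have BA : B \subset A.
    apply/subsetP => z /setU1P[->//|]; rewrite inE => /andP[zC' _].
    by have : z \in A :\ a; [rewrite AE' inE zC' | rewrite inE => /andP[]].
  exists B, (A :\: B); split; last by rewrite -[LHS](setID A B) (setIidPr BA).
    apply: chain_setU1 => [|z].
      by apply: chainS C'_chain; apply/subsetP => z; rewrite inE => /andP[].
    rewrite inE => /andP[_ zx]; rewrite comparable_sym le_comparable //.
    exact: le_trans zx (ltW xa).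
  have sideP y z : y \in A :\: B -> z \in A :\: B -> (y >< z)%O -> y \notin C'.
    rewrite !inE => /andP[+ yA] /andP[+ zA] yz.
    rewrite !(negb_or (_ == _)) => /andP[ya yB] /andP[za _].
    apply: contra yB => yC'; rewrite yC'; apply: x_max; rewrite inE yC'.
    by apply: (TP y z); rewrite // !inE ?ya ?za.
  apply/chainP => y z yAB zAB; apply: contraT => yz.
  have zy : (z >< y)%O by rewrite comparable_sym.
  have yC' := sideP _ _ yAB zAB yz; have zC' := sideP _ _ zAB yAB zy.
  have inD u : u \in A :\: B -> u \notin C' -> u \in D'.
    rewrite !inE negb_or => /andP[/andP[ua _] uA] uC'.
    have : u \in C' :|: D' by rewrite -AE' !inE ua.
    by rewrite inE (negPf uC').
  by have := chainP _ D'_chain y z (inD _ yAB yC') (inD _ zAB zC'); rewrite (negPf yz).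
have top_of (X : {set P}) z : chain X -> z \in X :&: T ->
    exists2 x, x \in X :&: T & forall y, y \in X :&: T -> (y <= x)%O.
  move=> X_chain zX.
  case: (@arg_maxnP _ z (fun x => x \in X :&: T) (fun x => #|[set y | (y < x)%O]|) zX).
  move=> x xX x_max; exists x => // y yX.
  have /orP[xy|//] : (x <= y)%O || (y <= x)%O.
    by move: xX yX; rewrite !inE => /andP[xX _] /andP[yX _]; apply: (chainP _ X_chain).
  have [->//|neq] := eqVneq x y; have := x_max y yX.
  rewrite /= leqNgt => /negP[]; apply: proper_card; apply/properP.
  have {}xy : (x < y)%O by rewrite lt_neqAle neq.
  split; last by exists x; rewrite !inE ?ltxx.
  by apply/subsetP => u; rewrite !inE => /lt_trans; apply.
have memA u : (u \in A :\ a) = (u \in C) || (u \in D) by rewrite AE inE.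
have [T0|/set0Pn[x xT]] := eqVneq T set0.
  exists (A :\ a), [set a]; rewrite setUC setD1K //; split=> //.
    apply/chainP => y z yA zA; apply: contraT => yz.
    by have := TP y z yA zA yz; rewrite T0 inE.
  by apply/chainP => y z /set1P-> /set1P->; apply: comparablexx.
have other y : y \in T -> exists2 z, z \in T & (y >< z)%O.
  rewrite inE => /andP[yA /existsP[z /andP[zA yz]]]; exists z => //.
  by apply: (TP z y); rewrite // comparable_sym.
have TA y : y \in T -> y \in A :\ a by rewrite inE => /andP[].
have swap y z (X Y : {set P}) : chain X -> A :\ a = X :|: Y ->
    y \in X -> z \in T -> (y >< z)%O -> z \in Y :&: T.
  move=> X_chain AXY yX zT yz; rewrite inE zT andbT.
  have : z \in X :|: Y by rewrite -AXY TA.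
  case/setUP => // zX; have := chainP _ X_chain y z yX zX.
  by rewrite (negPf yz).
have AE2 : A :\ a = D :|: C by rewrite setUC.
have [c cT] : exists c, c \in C :&: T.
  have [y yT xy] := other x xT.
  have := TA x xT; rewrite memA => /orP[xC|xD]; first by exists x; rewrite inE xC.
  by exists y; apply: (swap x y D C).
have [e eT] : exists e, e \in D :&: T.
  have /setIP[cC cT'] := cT; have [y yT cy] := other c cT'.
  by exists y; apply: (swap c y C D).
have [x1 /setIP[x1C x1T] x1_max] := top_of C c C_chain cT.
have [x2 /setIP[x2D x2T] x2_max] := top_of D e D_chain eT.
have x12 : (x1 >< x2)%O.
  have [y yT x1y] := other x1 x1T; have [z zT x2z] := other x2 x2T.
  have yx2 := x2_max y (swap _ _ C D C_chain AE x1C yT x1y).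
  have zx1 := x1_max z (swap _ _ D C D_chain AE2 x2D zT x2z).
  rewrite /Order.comparable negb_or; apply/andP; split.
    by apply: contra x2z => /(le_trans zx1) zx2; rewrite comparable_sym le_comparable.
  by apply: contra x1y => /(le_trans yx2) yx1; rewrite comparable_sym le_comparable.
have below y : y \in T -> (y >=< a)%O -> (y < a)%O.
  move=> /TA; rewrite !inE => /andP[ya yA]; rewrite /Order.comparable lt_neqAle ya.
  case/orP=> // ay; have := a_top y yA; by rewrite lt_neqAle eq_sym ya ay.
have [x1a|x1a] := boolP (x1 >=< a)%O.
  exact: (reduce C D x1) C_chain D_chain AE x1C x1_max (below _ x1T x1a).
have [x2a|x2a] := boolP (x2 >=< a)%O.
  exact: (reduce D C x2) D_chain C_chain AE2 x2D x2_max (below _ x2T x2a).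
have := A2 [set x1; x2; a]; have /setD1P[ax1 x1A] := TA _ x1T.
have /setD1P[ax2 x2A] := TA _ x2T.
have neq12 : x1 != x2 by apply: contraNneq x12 => ->; apply: comparablexx.
rewrite -setUA cardsU1 cards2 !inE negb_or neq12 ax1 ax2 /= => small.
suff : (3 <= 2)%N by []; apply: small.
  by apply/subsetP => y /setU1P[->|/set2P[]->].
have incomp : {in [set x1; x2; a] &, forall y z, y != z -> (y >< z)%O}.
  by move=> y z; rewrite !inE -!orbA => /or3P[]/eqP-> /or3P[]/eqP->;
     rewrite ?eqxx // comparable_sym.
rewrite setUA; apply/forall_inP => y yB; apply/forall_inP => z zB.
apply/implyP => yz; apply: contraT => neq; have := incomp y z yB zB neq.
by rewrite le_comparable.
Qed.
End Chains.

Section IdealLattice.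
Variables (d : Order.disp_t) (L : finTBDistrLatticeType d).
Variables (d' : Order.disp_t) (P : finPOrderType d') (f : L -> {set P}).
Hypothesis f_iso : ideal_lattice_iso f.
Implicit Types (x y z : L) (p q : P) (I J : {set P}).

Lemma order_idealP I :
  reflect (forall p q, p \in I -> (q <= p)%O -> q \in I) (order_ideal I).
Proof.
apply: (iffP forall_inP) => [H p q /H/forallP/(_ q)/implyP|H p pI]; first exact.
by apply/forallP => q; apply/implyP; apply: H.
Qed.

Lemma ideal_iso_le x y : (x <= y)%O = (f x \subset f y).
Proof. by case: f_iso => f_le _ _; rewrite f_le. Qed.

Lemma ideal_iso_inj : injective f.
Proof. by move=> x y fxy; apply/eqP; rewrite eq_le !ideal_iso_le fxy subxx. Qed.

Lemma ideal_iso_bot : f \bot%O = set0.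
Proof.
case: f_iso => _ _ f_surj; have [|x fx] := f_surj set0.
  by apply/order_idealP => p q; rewrite inE.
by apply/eqP; rewrite -subset0 -fx -ideal_iso_le le0x.
Qed.

Lemma ideal_iso_top : f \top%O = setT.
Proof.
case: f_iso => _ _ f_surj; have [|x fx] := f_surj setT.
  by apply/order_idealP => p q; rewrite !inE.
by apply/eqP; rewrite -subTset -fx -ideal_iso_le lex1.
Qed.

(** Adding to an ideal a minimal element of its difference with a larger ideal
    gives an ideal. *)
Lemma ideal_iso_cover x y : (x < y)%O ->
  exists z, [/\ (x < z)%O, (z <= y)%O & #|f z| = #|f x|.+1].
Proof.
case: f_iso => _ f_ideal f_surj.
rewrite lt_neqAle ideal_iso_le => /andP[neq xy].
have [p0 p0P] : exists p, p \in f y :\: f x.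
  apply/set0Pn; apply: contra_neq neq => /eqP; rewrite setD_eq0 => yx.
  by apply: ideal_iso_inj; apply/eqP; rewrite eqEsubset xy.
case: (@arg_minnP _ p0 (fun p => p \in f y :\: f x)
  (fun p => #|[set q | (q < p)%O]|) p0P) => p /setDP[py px] p_min.
have below q : (q < p)%O -> q \in f x.
  move=> qp; apply: contraT => qx; have := p_min q.
  rewrite inE qx (order_idealP _ (f_ideal y) p) ?(ltW qp) // => /(_ isT).
  rewrite /= leqNgt => /negP[]; apply: proper_card; apply/properP.
  split; last by exists q; rewrite !inE ?ltxx.
  by apply/subsetP => u; rewrite !inE => /lt_trans; apply.
have [|z fz] := f_surj (p |: f x).
  apply/order_idealP => u v /setU1P[->|ux] vu; last first.
    by rewrite inE (order_idealP _ (f_ideal x) u) ?orbT.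
  move: vu; rewrite le_eqVlt => /predU1P[->|/below vx]; first exact: setU11.
  by rewrite inE vx orbT.
exists z; rewrite ideal_iso_le fz subUset sub1set py xy cardsU1 px; split=> //.
rewrite lt_neqAle ideal_iso_le fz subsetUr andbT.
by apply: contraNneq px => ->; rewrite fz setU11.
Qed.

(** If the largest element x of C of rank at most r had smaller rank, an element
    covering x below the next element y of C could be added to C. *)
Lemma maxchain_rank (C : {set L}) r : maxset (@chain d L) C -> (r <= #|P|)%N ->
  exists2 x, x \in C & #|f x| = r.
Proof.
move=> C_max rP; have /chainP C_chain := maxsetp C_max.
have botC : \bot%O \in C.
  by apply: maxchain_mem => // y _; rewrite le_comparable ?le0x.
have topC : \top%O \in C.
  by apply: maxchain_mem => // y _; rewrite comparable_sym le_comparable ?lex1.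
have bot_r : (\bot%O \in C) && (#|f \bot%O| <= r)%N by rewrite botC ideal_iso_bot cards0.
case: (@arg_maxnP _ \bot%O (fun x => (x \in C) && (#|f x| <= r)%N)
  (fun x => #|f x|) bot_r) => x /andP[xC xr] x_max.
exists x => //; apply/eqP; rewrite eqn_leq xr /=.
rewrite leqNgt; apply/negP => {}xr.
have x_top : (x < \top)%O.
  rewrite lt_neqAle lex1 andbT; apply: contraTneq xr => ->.
  by rewrite ideal_iso_top cardsT -leqNgt.
have topP : (\top%O \in C) && (x < \top)%O by rewrite topC.
case: (@arg_minnP _ \top%O (fun y => (y \in C) && (x < y)%O) (fun y => #|f y|) topP).
move=> y /andP[yC xy] y_min; have [z [xz zy fz]] := ideal_iso_cover xy.
suff zC : z \in C.
  by have := x_max z; rewrite zC fz xr => /(_ isT) /=; rewrite ltnn.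
apply: maxchain_mem => // c cC; have [xc|xc] := boolP (x < c)%O.
  apply/le_comparable/(le_trans zy); have /orP[//|cy] := C_chain y c yC cC.
  have := y_min c; rewrite cC xc => /(_ isT) /= le_card.
  rewrite ideal_iso_le; move: cy; rewrite ideal_iso_le => cy.
  move: (subset_leqif_card cy) => -[_]; rewrite eqn_leq le_card.
  by rewrite subset_leq_card // => /esym.
rewrite comparable_sym le_comparable // (le_trans _ (ltW xz)) //.
by have /orP[|//] := C_chain x c xC cC; rewrite le_eqVlt (negPf xc) orbF => /eqP->.
Qed.

End IdealLattice.

(** An embedding in the plane grid for which the sum of the coordinates is the
    rank, so that maximal chains become monotone lattice paths. *)
Record plane_coordinates d (L : finTBDistrLatticeType d) := PlaneCoordinates {
  coord1 : L -> nat;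
  coord2 : L -> nat;
  height : nat;
  coord_le : forall x y,
    (x <= y)%O = (coord1 x <= coord1 y)%N && (coord2 x <= coord2 y)%N;
  coord_height : forall x, (coord1 x + coord2 x <= height)%N;
  coord_rank : forall C, maxset (@chain d L) C -> forall r, (r <= height)%N ->
    exists2 x, x \in C & (coord1 x + coord2 x = r)%N }.

(** The intersections of ideals with a chain are nested. *)
Lemma ideal_chain_card d (P : finPOrderType d) (I J C : {set P}) :
    order_ideal I -> order_ideal J -> chain C ->
  (I :&: C \subset J :&: C) = (#|I :&: C| <= #|J :&: C|)%N.
Proof.
move=> I_ideal J_ideal C_chain; apply/idP/idP => [|le_card]; first exact: subset_leq_card.
apply: contraT => /subsetPn[p /setIP[pI pC]]; rewrite inE pC andbT => pJ.
have JI : J :&: C \subset I :&: C.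
  apply/subsetP => q /setIP[qJ qC]; rewrite inE qC andbT.
  have /orP[pq|qp] := chainP _ C_chain p q pC qC; last exact: (order_idealP _ I_ideal p).
  by rewrite (order_idealP _ J_ideal q p) in pJ.
have /eqP JIE : J :&: C == I :&: C by rewrite eqEcard JI.
by move: pJ; have : p \in J :&: C; [rewrite JIE inE pI | rewrite inE => /andP[->]].
Qed.

(** The coordinates of an ideal are the numbers of its elements in the two chains
    of a cover of the poset. *)
Lemma planar_coordinates d (L : finTBDistrLatticeType d) :
  planar L -> inhabited (plane_coordinates L).
Proof.
case=> d' [P [f [f_iso w2]]]; have [_ f_ideal _] := f_iso.
have [|C [D [C_chain D_chain CD]]] := @two_chain_cover _ P setT.
  by move=> B _ B_anti; apply: leq_trans w2; apply: (leq_bigmax_cond _ B_anti).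
have {}D_chain : chain (~: C).
  apply: chainS D_chain; apply/subsetP => x; rewrite inE => xC.
  by have : x \in C :|: D; [rewrite -CD inE | rewrite inE (negPf xC)].
have rankE x : (#|f x :&: C| + #|f x :&: ~: C| = #|f x|)%N.
  by rewrite -setDE cardsID.
split; apply: (@PlaneCoordinates _ L (fun x => #|f x :&: C|)
  (fun x => #|f x :&: ~: C|) #|P|).
- move=> x y; rewrite -!ideal_chain_card // (ideal_iso_le f_iso).
  apply/idP/andP => [xy|[xyC xyD]]; first by rewrite !setSI.
  rewrite -[f x](setID _ C) setDE.
  rewrite subUset (subset_trans xyC (subsetIl _ _)).
  exact: subset_trans xyD (subsetIl _ _).
- by move=> x; rewrite rankE max_card.
move=> E E_max r rP; have [x xE fx] := maxchain_rank f_iso E_max rP.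
by exists x; rewrite ?rankE.
Qed.

(** * The lattice of maximal chains of a planar lattice *)

Section ChainLattice.
Variables (d : Order.disp_t) (L : finTBDistrLatticeType d).
Variable pc : plane_coordinates L.
Notation i := (coord1 pc).
Notation h := (height pc).
Implicit Types (C D E : maxchain L) (x y : L) (r : 'I_h.+1).

Definition coord_rk x := (coord1 pc x + coord2 pc x)%N.

Lemma coord_inj x y : coord_rk x = coord_rk y -> i x = i y -> x = y.
Proof.
rewrite /coord_rk => rk_eq i_eq; have j_eq : coord2 pc x = coord2 pc y by lia.
by apply/eqP; rewrite eq_le !(coord_le pc) i_eq j_eq !leqnn.
Qed.

Lemma comparable_rk x y : (x >=< y)%O -> coord_rk x = coord_rk y -> x = y.
Proof.
rewrite /Order.comparable !(coord_le pc) /coord_rk => xy rk_eq.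
by apply: coord_inj; rewrite /coord_rk; lia.
Qed.

Lemma comparable_rk_le x y : (x >=< y)%O -> (coord_rk x <= coord_rk y)%N -> (x <= y)%O.
Proof.
rewrite /Order.comparable !(coord_le pc) /coord_rk => xy rk_le; lia.
Qed.

Lemma coord_rk_lt x : (coord_rk x < h.+1)%N.
Proof. by rewrite ltnS coord_height. Qed.

Lemma chain_at_exists C r : [exists x, (x \in val C) && (coord_rk x == r)].
Proof.
have r_le : (r <= h)%N by rewrite -ltnS.
have [x xC rx] := coord_rank (valP C) r_le.
by apply/existsP; exists x; rewrite xC /coord_rk rx eqxx.
Qed.

Definition chain_at C r : L := xchoose (existsP (chain_at_exists C r)).

Lemma chain_at_mem C r : chain_at C r \in val C.
Proof. by have /andP[] := xchooseP (existsP (chain_at_exists C r)). Qed.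

Lemma chain_at_rk C r : coord_rk (chain_at C r) = r.
Proof. by have /andP[_ /eqP] := xchooseP (existsP (chain_at_exists C r)). Qed.

Lemma maxchain_comparable C x y : x \in val C -> y \in val C -> (x >=< y)%O.
Proof. by move: x y; apply/chainP/maxsetp/(valP C). Qed.

Lemma chain_atE C x r : x \in val C -> coord_rk x = r -> x = chain_at C r.
Proof.
move=> xC xr; apply: comparable_rk; last by rewrite chain_at_rk.
exact: maxchain_comparable xC (chain_at_mem C r).
Qed.

Lemma mem_maxchain C x : (x \in val C) = (x == chain_at C (Ordinal (coord_rk_lt x))).
Proof.
apply/idP/eqP => [xC|->]; last exact: chain_at_mem.
exact: chain_atE.
Qed.

Lemma maxchain_ext C D : (forall r, i (chain_at C r) = i (chain_at D r)) -> C = D.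
Proof.
move=> CD; apply/val_inj/setP => x; rewrite !mem_maxchain; congr (_ == _).
by apply: coord_inj; rewrite ?chain_at_rk.
Qed.

(** Selecting in every rank the element with the smaller first coordinate, or
    the larger one if b holds, gives the lower or upper envelope of two lattice
    paths, which is a lattice path. *)
Definition select (b : bool) x y := if (i x <= i y)%N (+) b then x else y.

Definition select_chain b C D : {set L} :=
  [set select b (chain_at C r) (chain_at D r) | r : 'I_h.+1].

Lemma select_rk b x y : coord_rk x = coord_rk y -> coord_rk (select b x y) = coord_rk x.
Proof. by rewrite /select; case: ifP. Qed.

Lemma select_maxchain b C D : maxset (@chain d L) (select_chain b C D).
Proof.
have select_at r : coord_rk (select b (chain_at C r) (chain_at D r)) = r.
  by rewrite select_rk !chain_at_rk.
apply/maxsetP; split=> [|E /chainP E_chain sub].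
  apply/chainP => _ _ /imsetP[r _ ->] /imsetP[r' _ ->].
  wlog rr' : r r' / (r <= r')%N.
    move=> H; have [/H//|/ltnW/H] := leqP r r'.
    by rewrite comparable_sym.
  apply: le_comparable; have le_at E : (chain_at E r <= chain_at E r')%O.
    apply: comparable_rk_le; last by rewrite !chain_at_rk.
    exact: maxchain_comparable (chain_at_mem E r) (chain_at_mem E r').
  move: (le_at C) (le_at D) (chain_at_rk C r) (chain_at_rk D r).
  move: (chain_at_rk C r') (chain_at_rk D r').
  rewrite /select /coord_rk !(coord_le pc).
  by case: (b); rewrite ?addbT ?addbF; (case: ifP => ?); (case: ifP => ?); lia.
apply/eqP; rewrite eqEsubset sub andbT; apply/subsetP => x xE.
pose r := Ordinal (coord_rk_lt x).
have selE : select b (chain_at C r) (chain_at D r) \in E.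
  by apply/(subsetP sub)/imset_f.
have -> : x = select b (chain_at C r) (chain_at D r).
  by apply: comparable_rk; [apply: E_chain | rewrite select_at].
exact: imset_f.
Qed.

Definition chain_select b C D : maxchain L := Sub _ (select_maxchain b C D).

Lemma chain_at_select b C D r :
  chain_at (chain_select b C D) r = select b (chain_at C r) (chain_at D r).
Proof.
apply/esym/chain_atE; first by apply/imsetP; exists r.
by rewrite select_rk !chain_at_rk.
Qed.

Lemma i_select b x y :
  i (select b x y) = if b then maxn (i x) (i y) else minn (i x) (i y).
Proof. by rewrite /select; case: b; rewrite ?addbT ?addbF; case: ifP; lia. Qed.

(** The coordinates are recorded in the type because the order depends on
    them. *)
Definition chain_lattice (_ : plane_coordinates L) : Type := maxchain L.
Notation M := (chain_lattice pc).

HB.instance Definition _ := Finite.copy M (maxchain L).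

Definition chain_le : rel M :=
  fun C D => [forall r, (i (chain_at C r) <= i (chain_at D r))%N].

Definition chain_lt : rel M := fun C D => (D != C) && chain_le C D.

Definition chain_meet : M -> M -> M :=
  chain_select false.

Definition chain_join : M -> M -> M :=
  chain_select true.

Lemma i_meet C D r :
  i (chain_at (chain_meet C D) r) = minn (i (chain_at C r)) (i (chain_at D r)).
Proof. by rewrite chain_at_select i_select. Qed.

Lemma i_join C D r :
  i (chain_at (chain_join C D) r) = maxn (i (chain_at C r)) (i (chain_at D r)).
Proof. by rewrite chain_at_select i_select. Qed.

Fact chain_le_def C D : chain_le C D = (chain_meet C D == C).
Proof.
apply/forallP/eqP => [CD|<- r]; last by rewrite i_meet geq_minr.
by apply: maxchain_ext => r; rewrite i_meet; apply/minn_idPl.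
Qed.

Fact chain_meetC : commutative chain_meet.
Proof. by move=> C D; apply: maxchain_ext => r; rewrite !i_meet minnC. Qed.

Fact chain_joinC : commutative chain_join.
Proof. by move=> C D; apply: maxchain_ext => r; rewrite !i_join maxnC. Qed.

Fact chain_meetA : associative chain_meet.
Proof. by move=> C D E; apply: maxchain_ext => r; rewrite !i_meet minnA. Qed.

Fact chain_joinA : associative chain_join.
Proof. by move=> C D E; apply: maxchain_ext => r; rewrite !i_join maxnA. Qed.

Fact chain_joinKI D C : chain_meet C (chain_join C D) = C.
Proof. by apply: maxchain_ext => r; rewrite i_meet i_join; lia. Qed.

Fact chain_meetKU D C : chain_join C (chain_meet C D) = C.
Proof. by apply: maxchain_ext => r; rewrite i_join i_meet; lia. Qed.

Fact chain_meetUl : left_distributive chain_meet chain_join.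
Proof. by move=> C D E; apply: maxchain_ext => r; rewrite !(i_meet, i_join); lia. Qed.

Fact chain_meetxx : idempotent_op chain_meet.
Proof. by move=> C; apply: maxchain_ext => r; rewrite i_meet minnn. Qed.

Fact chain_lt_def C D : chain_lt C D = (D != C) && chain_le C D.
Proof. by []. Qed.

HB.instance Definition _ :=
  Order.isMeetJoinDistrLattice.Build d M chain_le_def chain_lt_def
    chain_meetC chain_joinC chain_meetA chain_joinA chain_joinKI chain_meetKU
    chain_meetUl chain_meetxx.

Lemma maxchain_exists : exists C : maxchain L, True.
Proof.
by have [C C_max _] := maxset_exists (chain_set0 L); exists (Sub C C_max).
Qed.

Lemma chain_lattice_bounds :
  exists BT : M * M,
    [forall C : M, (BT.1 <= C)%O && (C <= BT.2)%O].
Proof.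
have [C0 _] := maxchain_exists.
suff [B [T BT]] : exists B T : M,
    forall C : M, C \in enum {: M} -> (B <= C)%O && (C <= T)%O.
  by exists (B, T); apply/forallP => C; apply: BT; rewrite mem_enum.
elim: (enum _) => [|D s [B [T BT]]]; first by exists C0, C0.
exists (Order.meet D B), (Order.join D T) => C.
rewrite inE => /predU1P[->|/BT/andP[BC CT]].
  by rewrite leIl leUl.
by rewrite (le_trans (leIr _ _) BC) (le_trans CT (leUr _ _)).
Qed.

Fact chain_bottomP (C : M) : ((xchoose chain_lattice_bounds).1 <= C)%O.
Proof. by have /forallP/(_ C)/andP[] := xchooseP chain_lattice_bounds. Qed.

Fact chain_topP (C : M) : (C <= (xchoose chain_lattice_bounds).2)%O.
Proof. by have /forallP/(_ C)/andP[] := xchooseP chain_lattice_bounds. Qed.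

HB.instance Definition _ := Order.hasBottom.Build d M chain_bottomP.
HB.instance Definition _ := Order.hasTop.Build d M chain_topP.

Lemma chain_leE (C D : M) :
  (C <= D)%O = [forall r, (i (chain_at C r) <= i (chain_at D r))%N].
Proof. by []. Qed.

Definition chain_exponent (C : M) : 'X_{1..#|L|} :=
  chain_mnm (@enum_rank L) (val C).

End ChainLattice.

Lemma chain_mnmE (n : nat) d (L : finPOrderType d) (lab : L -> 'I_n)
    (C : {set L}) x :
  injective lab -> chain_mnm lab C (lab x) = (x \in C).
Proof.
move=> lab_inj; rewrite mnm_sumE; under eq_bigr do rewrite mnm1E (inj_eq lab_inj).
have [xC|xC] := boolP (x \in C).
  by rewrite (bigD1 x) //= eqxx big1 // => y /andP[_ /negPf->].
by apply: big1 => y yC; case: eqP => // yx; rewrite yx (negPf xC) in yC.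
Qed.

Section PlanarAlgebra.
Variables (K : fieldType) (d : Order.disp_t) (L : finTBDistrLatticeType d).
Variable pc : plane_coordinates L.
Notation M := (chain_lattice pc).
Notation i := (coord1 pc).



Lemma chain_exponentE (C : M) x :
  chain_exponent C (enum_rank x) = (x \in val (C : maxchain L)).
Proof. by apply: chain_mnmE => //; apply: enum_rank_inj. Qed.

(** The product of two chains is a union of pairs of elements of the same rank,
    and an element of a given rank is determined by its first coordinate. *)
Lemma chain_exponentP : hibi_exponents (@chain_exponent d L pc).
Proof.
split=> [C D|C|m m' C eq_im mC C_min D m'D].
- apply/mnmP => k; rewrite -(enum_valK k) !mnmDE !chain_exponentE !(mem_maxchain pc).
  rewrite [Order.meet C D]/(chain_meet C D) [Order.join C D]/(chain_join C D).
  by rewrite !chain_at_select /select; case: (_ <= _)%N => //=; rewrite addnC.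
- apply/eqP => /mnmP/(_ (enum_rank (chain_at C (ord0 : 'I_(height pc).+1)))).
  by rewrite chain_exponentE chain_at_mem mnm0E.
rewrite chain_leE; apply/forallP => r; pose x := chain_at D r.
have : (0 < mnm_image (@chain_exponent d L pc) m (enum_rank x))%N.
  rewrite eq_im mnm_imageE (bigD1 (enum_rank D)) //= addn_gt0 enum_rankK.
  by rewrite chain_exponentE chain_at_mem mul1n lt0n m'D.
rewrite mnm_imageE lt0n sum_nat_eq0 negb_forall => /existsP[k] /=.
rewrite chain_exponentE muln_eq0 negb_or eqb0 negbK => /andP[xE mk].
have := C_min (enum_val k); rewrite enum_valK => /(_ mk).
rewrite chain_leE => /forallP/(_ r)/leq_trans; apply.
by rewrite -(chain_atE xE (chain_at_rk D r)).
Qed.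

Lemma planar_quadratic_gb : has_quadratic_drl_gb (@chain_ideal K d L).
Proof.
have [σ σP] := antitone_perm_exists M.
exact: (toric_has_quadratic_gb K chain_exponentP σP).
Qed.

Lemma planar_quadratically_generated : quadratically_generated (@chain_ideal K d L).
Proof. exact: (toric_quadratically_generated K chain_exponentP). Qed.

End PlanarAlgebra.

(** * The chain algebra of a planar lattice is a Hibi ring *)

Section ChainPi.
Variables (K : fieldType) (d : Order.disp_t) (L : finTBDistrLatticeType d).
Notation T := {mpoly K[#|maxchain L|]}.
Notation A := (chain_algebra K L).

Lemma chain_map_in (p : T) : chain_map p \in @chain_subalg K d L.
Proof. by apply/asboolP; exists p. Qed.

Definition chain_pi (p : T) : A := ChainAlgebra (chain_map_in p).

Lemma chain_pi_is_linear : linear chain_pi.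
Proof.
move=> c p q; apply: val_inj.
by rewrite /= /chain_map comp_mpolyD comp_mpolyZ.
Qed.

Lemma chain_pi_is_multiplicative : multiplicative chain_pi.
Proof.
split=> [p q|]; apply: val_inj; first by rewrite /= /chain_map rmorphM.
by rewrite /= /chain_map comp_mpoly1.
Qed.

HB.instance Definition _ := GRing.isLinear.Build K T A _ chain_pi chain_pi_is_linear.
HB.instance Definition _ :=
  GRing.isMultiplicative.Build T A chain_pi chain_pi_is_multiplicative.

Lemma chain_pi_surj (x : A) : exists p, x = chain_pi p.
Proof. by case: x => x xP; have /asboolP[p xE] := xP; exists p; apply: val_inj. Qed.

Lemma chain_pi_eq0 p : chain_pi p = 0 <-> chain_ideal p.
Proof. by split=> [/(congr1 val)|p0] //; apply: val_inj. Qed.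

Lemma chain_gradingE k (x : A) :
  chain_grading k x <-> exists2 p, p \is k.-homog & x = chain_pi p.
Proof.
split=> [[p [p_homog xE]]|[p p_homog ->]]; last by exists p.
by exists p => //; apply: val_inj.
Qed.

Section Hibi.
Variable pc : plane_coordinates L.
Notation M := (chain_lattice pc).
Notation B := (hibi_ring K M).

Lemma chain_pi_hibi (p : T) :
  chain_pi p = 0 <-> hibi_pi (p : {mpoly K[#|{: M}|]}) = 0 :> B.
Proof. by rewrite chain_pi_eq0 -(toric_eq0 (chain_exponentP pc)). Qed.

Definition chain_to_hibi (x : A) : B :=
  hibi_pi (sval (cid (chain_pi_surj x)) : {mpoly K[#|{: M}|]}).

Lemma chain_to_hibiE p : chain_to_hibi (chain_pi p) = hibi_pi (p : {mpoly K[#|{: M}|]}).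
Proof.
rewrite /chain_to_hibi; case: cid => q /= qE.
apply/eqP; rewrite -subr_eq0 -raddfB; apply/eqP/chain_pi_hibi.
by rewrite raddfB /= -qE subrr.
Qed.

Lemma chain_to_hibi_linear : linear chain_to_hibi.
Proof.
move=> c x y; have [p ->] := chain_pi_surj x; have [q ->] := chain_pi_surj y.
by rewrite -linearP !chain_to_hibiE raddfD /= hibi_piZ.
Qed.

Lemma chain_to_hibi_multiplicative : multiplicative chain_to_hibi.
Proof.
split=> [x y|]; last by rewrite -(rmorph1 chain_pi) chain_to_hibiE rmorph1.
have [p ->] := chain_pi_surj x; have [q ->] := chain_pi_surj y.
by rewrite -rmorphM !chain_to_hibiE rmorphM.
Qed.

HB.instance Definition _ :=
  GRing.isLinear.Build K A B _ chain_to_hibi chain_to_hibi_linear.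
HB.instance Definition _ :=
  GRing.isMultiplicative.Build A B chain_to_hibi chain_to_hibi_multiplicative.

Lemma chain_to_hibi_iso : graded_iso (@chain_grading K d L) (@hibi_grading K d M).
Proof.
have inj : injective chain_to_hibi.
  move=> x y; have [p ->] := chain_pi_surj x; have [q ->] := chain_pi_surj y.
  rewrite !chain_to_hibiE => /eqP; rewrite -subr_eq0 -raddfB => /eqP/chain_pi_hibi.
  by rewrite raddfB /= => /eqP; rewrite subr_eq0 => /eqP.
have surj (z : B) : exists x, chain_to_hibi x = z.
  by have [p ->] := hibi_pi_surj z; exists (chain_pi p); rewrite chain_to_hibiE.
exists (GRing.LRMorphism.clone _ _ _ _ chain_to_hibi _); split.
  exists (fun z => sval (cid (surj z))) => [x|z]; last exact: (svalP (cid (surj z))).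
  by apply: inj; apply: (svalP (cid (surj (chain_to_hibi x)))).
move=> k x; rewrite chain_gradingE /=; split=> [[p p_homog ->]|[p [p_homog xE]]].
  by exists p; rewrite chain_to_hibiE.
by exists p => //; apply: inj; rewrite chain_to_hibiE.
Qed.

End Hibi.
End ChainPi.

Lemma koszul_graded_iso (K : fieldType) (A B : comAlgType K)
    (grA : nat -> A -> Prop) (grB : nat -> B -> Prop) :
  graded_iso grA grB -> koszul grB -> koszul grA.
Proof.
case=> f [f_bij grE] [b [D [b0 Dlin D0 Dex]]].
have [g fK gK] : exists2 g : B -> A, forall x, g (f x) = x & forall y, f (g y) = y.
  by case: f_bij => g fK gK; exists g.
have f_inj x y : f x = f y -> x = y by move=> fxy; rewrite -(fK x) fxy fK.
have g_add : zmod_morphism g by move=> x y; apply: f_inj; rewrite raddfB /= !gK.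
have g_mul : monoid_morphism g.
  by split=> [|x y]; apply: f_inj; rewrite ?rmorph1 ?rmorphM /= !gK.
pose G : {rmorphism B -> A} := HB.pack g
  (GRing.isZmodMorphism.Build B A g g_add)
  (GRing.isMonoidMorphism.Build B A g g_mul).
have mapfK m n (X : 'M_(m, n)) : map_mx G (map_mx f X) = X.
  by apply/matrixP => i j; rewrite !mxE /= fK.
have mapGK m n (X : 'M_(m, n)) : map_mx f (map_mx G X) = X.
  by apply/matrixP => i j; rewrite !mxE /= gK.
have grG k x : grB k x <-> grA k (G x) by rewrite grE /= gK.
have irrE x : irrelevant_ideal grA x <-> irrelevant_ideal grB (f x).
  split=> -[m [y [yP xE]]].
    exists m, (f \o y); split=> [k|]; first exact/grE.
    by rewrite xE raddf_sum.
  exists m, (G \o y); split=> [k|]; first exact/grG.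
  by rewrite -[LHS]fK xE -[g _]/(G _) raddf_sum.
exists b, (fun i => map_mx G (D i)); split=> //.
- by move=> i j k; rewrite mxE; apply/grG.
- move=> v; split=> [v_irr|[w ->] j].
    have [|w vE] := (D0 (map_mx f v)).1; first by move=> j; rewrite mxE; apply/irrE.
    by exists (map_mx G w); rewrite -map_mxM -vE mapfK.
  apply/irrE; have := (D0 (map_mx f w *m D 0)).2 (ex_intro _ _ erefl) j.
  by rewrite -[D 0 in X in X -> _]mapGK -map_mxM mxE.
move=> i v; split=> [vD|[w ->]].
  have [|w vE] := (Dex i (map_mx f v)).1.
    by rewrite -[D i]mapGK -map_mxM vD map_mx0.
  by exists (map_mx G w); rewrite -map_mxM -vE mapfK.
rewrite -[w]mapfK -!map_mxM (_ : _ *m D i = 0) ?map_mx0 //.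
by apply/(Dex i); exists (map_mx f w).
Qed.

(** * Nonplanar lattices contain a cube *)

Section Birkhoff.
Variables (d : Order.disp_t) (L : finTBDistrLatticeType d).

Definition join_irreducible := {p : L | join_prime p && (p != \bot%O)}.

HB.instance Definition _ := SubFinite.on join_irreducible.
HB.instance Definition _ := [SubChoice_isSubPOrder of join_irreducible by <: with d].

Lemma le_join_irreducible (p q : join_irreducible) : (p <= q)%O = (val p <= val q)%O.
Proof. by []. Qed.

(** Birkhoff's representation: the join of an ideal has no other join-irreducible
    elements below it, by join-primeness. *)
Lemma birkhoff :
  ideal_lattice_iso (fun x : L => [set p : join_irreducible | (val p <= x)%O]).
Proof.
split=> [x y|x|I /order_idealP I_ideal].
- apply/subsetP/idP => [sub|xy p]; last first.
    by rewrite !inE => /le_trans; apply.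
  apply: contraT => /join_prime_separation[p [pP px py]].
  have p0 : p != \bot%O by apply: contraNneq py => ->; rewrite le0x.
  have pPP : join_prime p && (p != \bot%O) by rewrite pP.
  by have := sub (Sub p pPP); rewrite !inE SubK px (negPf py) => /(_ isT).
- by apply/order_idealP => p q; rewrite !inE le_join_irreducible => px /le_trans; apply.
exists (\join_(p in I) val p)%O; apply/setP => p; rewrite inE.
apply/idP/idP => [|pI]; last exact: (joins_sup _ pI).
have /andP[pP p0] := valP p.
pose Q x := (val p <= x)%O -> p \in I; rewrite -/(Q _).
apply: (big_ind Q) => [|x y Qx Qy|q qI].
- by rewrite /Q lex0 (negPf p0).
- by rewrite /Q join_primeU // => /orP[/Qx|/Qy].
by rewrite /Q -le_join_irreducible => /(I_ideal _ _ qI).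
Qed.

End Birkhoff.

Section Cube.
Variables (d : Order.disp_t) (L : finTBDistrLatticeType d).

(** The image of g is an interval, a Boolean lattice of rank three. *)
Definition cube (g : {set 'I_3} -> L) :=
  {mono g : S T / S \subset T >-> (S <= T)%O} /\
  forall x, (g set0 <= x)%O -> (x <= g setT)%O -> exists S, x = g S.

(** Given three incomparable join-irreducible elements, the ideal of all elements
    strictly below one of them can be enlarged by any subset of the three. *)
Lemma planar_or_cube : planar L \/ exists g, cube g.
Proof.
have f_iso := birkhoff L; set f := (fun x => _) in f_iso.
have [w2|] := leqP (width (join_irreducible L)) 2.
  by left; do 3!eexists; split; [exact: f_iso|].
rewrite /width => w3; right.
have [A A_anti A3] : exists2 A : {set join_irreducible L}, antichain A & (2 < #|A|)%N.
  apply: contrapT => no; move: w3; rewrite ltnNge => /negP; apply.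
  apply/bigmax_leqP => A A_anti; rewrite leqNgt; apply/negP => A3; apply: no.
  by exists A.
pose a (k : 'I_3) := enum_val (widen_ord A3 k).
have aA k : a k \in A by apply: enum_valP.
have a_inj : injective a by move=> k l /enum_val_inj/(congr1 val)/= ?; apply: val_inj.
have a_anti k l : (a k <= a l)%O -> k = l.
  have /forall_inP/(_ _ (aA k))/forall_inP/(_ _ (aA l))/implyP kl := A_anti.
  by move=> /kl/eqP/a_inj.
pose I0 := [set p | [exists k, (p < a k)%O]].
have [_ f_ideal f_surj] := f_iso.
have aI0 k : a k \notin I0.
  rewrite inE negb_exists; apply/forallP => l; apply/negP => kl.
  by have := a_anti k l (ltW kl) => E; rewrite E ltxx in kl.
have I_ideal (S : {set 'I_3}) : order_ideal (I0 :|: a @: S).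
  apply/order_idealP => p q; case/setUP => [|/imsetP[k kS ->]].
    rewrite inE => /existsP[k pk] qp; rewrite inE [q \in I0]inE.
    by apply/orP; left; apply/existsP; exists k; apply: le_lt_trans pk.
  rewrite le_eqVlt => /predU1P[->|qk]; first by rewrite inE imset_f ?orbT.
  by rewrite inE [q \in I0]inE; apply/orP; left; apply/existsP; exists k.
pose g S := sval (cid (f_surj _ (I_ideal S))).
have gE S : f (g S) = I0 :|: a @: S by apply: (svalP (cid (f_surj _ (I_ideal S)))).
exists g; split=> [S T|x].
  rewrite (ideal_iso_le f_iso) !gE; apply/subsetP/subsetP => [sub k kS|sub p].
    have : a k \in I0 :|: a @: T by apply: sub; rewrite inE imset_f ?orbT.
    by rewrite inE (negPf (aI0 k)) (mem_imset _ _ a_inj).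
  case/setUP => [pI|/imsetP[k /sub kT ->]]; first by rewrite inE pI.
  by rewrite inE imset_f ?orbT.
rewrite !(ideal_iso_le f_iso) !gE imset0 setU0 => I0x /subsetP xI.
exists (a @^-1: f x); apply: (ideal_iso_inj f_iso); rewrite gE.
apply/setP => p; apply/idP/setUP => [px|[/(subsetP I0x)//|/imsetP[k]]]; last first.
  by rewrite inE => + ->.
have /setUP[|/imsetP[k _ pk]] := xI p px; first by left.
by right; apply/imsetP; exists k; rewrite // inE -pk.
Qed.

End Cube.

(** * Six maximal chains through a cube *)

Section Hexagon.
Variables (d : Order.disp_t) (L : finTBDistrLatticeType d).
Variables (g : {set 'I_3} -> L) (g_cube : cube g).
Implicit Types (i j : 'I_3) (x y : L) (C D E : {set L}).

Definition atom i := g [set i].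
Definition coatom j := g (~: [set j]).

Let g_le S T : (g S <= g T)%O = (S \subset T). Proof. by case: g_cube => ->. Qed.

Lemma atom_comparable i i' : (atom i >=< atom i')%O = (i == i').
Proof.
rewrite /Order.comparable !g_le !sub1set !inE [i' == i]eq_sym.
by case: eqP.
Qed.

Lemma third_index i j : exists k, (k != i) && (k != j).
Proof.
case: (pickP [pred k | (k != i) && (k != j)]) => [k kP|no]; first by exists k.
have : (#|[set: 'I_3]| <= #|[set i; j]|)%N.
  apply/subset_leq_card/subsetP => k _; rewrite !inE; apply: contraFT (no k).
  by rewrite negb_or.
by rewrite cardsT card_ord cards2; case: (i != j).
Qed.

Lemma index_cases i j k l : i != j -> k != i -> k != j ->
  [\/ l = i, l = j | l = k].
Proof.
move=> ij ki kj; have : l \in [set i; j; k].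
  suff -> : [set i; j; k] = setT by rewrite inE.
  apply/eqP; rewrite eqEcard subsetT cardsT card_ord -setUA cardsU1 cards2 !inE.
  by rewrite negb_or ij [i == k]eq_sym [j == k]eq_sym ki kj.
by rewrite !inE -orbA => /or3P[]/eqP->; [constructor 1|constructor 2|constructor 3].
Qed.

Lemma atom_coatom i j : (atom i >=< coatom j)%O = (i != j).
Proof.
rewrite /Order.comparable !g_le sub1set !inE orb_idr // => /subsetP sub.
have [k /andP[ki kj]] := third_index i j.
by have := sub k; rewrite !inE (negPf ki) kj => /(_ isT).
Qed.

Lemma coatom_inj : injective coatom.
Proof.
move=> j j' eq_jj'; apply/eqP; apply: contraT => jj'.
have : (coatom j <= coatom j')%O by rewrite eq_jj'.
by rewrite g_le setCS sub1set inE eq_sym (negPf jj').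
Qed.

Lemma atom_neq_coatom i j : atom i != coatom j.
Proof.
apply/eqP => ij; have [k /andP[ki kj]] := third_index i j.
have := atom_comparable i k; rewrite ij comparable_sym atom_coatom kj.
by rewrite eq_sym (negPf ki).
Qed.

(** All chains below share a maximal chain of this complement of the open
    interval of the cube. *)
Definition outside := [set x : L | (x <= g set0)%O || (g setT <= x)%O].

Definition outside_chain C := chain C && (C \subset outside).

Lemma outside_exists :
  exists B : {set L}, maxset outside_chain B
                   /\ g set0 \in B /\ g setT \in B.
Proof.
have ends_chain : outside_chain [set g set0; g setT].
  apply/andP; split.
    apply/chainP => x y; have le01 : (g set0 <= g setT)%O by rewrite g_le sub0set.
    move=> /set2P[]-> /set2P[]->; rewrite ?comparablexx ?(le_comparable le01) //.
    by rewrite comparable_sym (le_comparable le01).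
  by apply/subsetP => x /set2P[]->; rewrite inE lexx ?orbT.
have [B B_max /subsetP B_ends] := maxset_exists ends_chain.
by exists B; rewrite !B_ends ?inE ?eqxx ?orbT.
Qed.

Definition base : {set L} := sval (cid outside_exists).

Lemma baseP : maxset outside_chain base
                   /\ g set0 \in base /\ g setT \in base.
Proof. exact: (svalP (cid outside_exists)). Qed.

Lemma base_comparable x S : x \in base -> (x >=< g S)%O.
Proof.
have [/maxsetp/andP[_ /subsetP sub] _] := baseP => /sub.
rewrite inE => /orP[x0|x1].
  by rewrite le_comparable // (le_trans x0) // g_le sub0set.
by rewrite comparable_sym le_comparable // (le_trans _ x1) // g_le subsetT.
Qed.

Lemma notin_base S : S != set0 -> S != setT -> g S \notin base.
Proof.
move=> S0 ST; have [/maxsetp/andP[_ /subsetP sub] _] := baseP.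
apply/negP => /sub; rewrite inE !g_le subset0 subTset.
by rewrite (negPf S0) (negPf ST).
Qed.

Lemma atom_notin_base i : atom i \notin base.
Proof.
apply: notin_base; first by apply/set0Pn; exists i; rewrite inE.
have [k /andP[ki _]] := third_index i i.
by apply/eqP => /setP/(_ k); rewrite !inE (negPf ki).
Qed.

Lemma coatom_notin_base j : coatom j \notin base.
Proof.
have [k /andP[kj _]] := third_index j j; apply: notin_base.
  by apply/set0Pn; exists k; rewrite !inE kj.
by apply/eqP => /setP/(_ j); rewrite !inE eqxx.
Qed.

Definition hex_set i j := coatom j |: (atom i |: base).

Lemma mem_hex i j x :
  (x \in hex_set i j : nat) = ((x \in base) + (x == atom i) + (x == coatom j))%N.
Proof.
rewrite !inE; have [->|_] := eqVneq x (coatom j).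
  by rewrite (negPf (coatom_notin_base j)) eq_sym (negPf (atom_neq_coatom i j)).
have [->|_] := eqVneq x (atom i); first by rewrite (negPf (atom_notin_base i)).
by rewrite /= !addn0.
Qed.

Lemma atom_eq k l : (atom k == atom l) = (k == l).
Proof.
apply/eqP/eqP => [eq_atom|-> //]; apply/eqP; rewrite -atom_comparable eq_atom.
exact: comparablexx.
Qed.

Lemma atom_mem_hex k i j : (atom k \in hex_set i j) = (k == i).
Proof.
rewrite !inE (negPf (atom_neq_coatom k j)) (negPf (atom_notin_base k)).
by rewrite atom_eq orbF.
Qed.

Lemma coatom_mem_hex k i j : (coatom k \in hex_set i j) = (k == j).
Proof.
rewrite !inE (negPf (coatom_notin_base k)) [coatom k == atom i]eq_sym.
by rewrite (negPf (atom_neq_coatom i k)) (inj_eq coatom_inj) !orbF.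
Qed.

(** An element comparable to the whole chain lies in the base, by maximality of
    the base, or in the cube; there only the atom and the coatom are comparable
    to both of them. *)
Lemma hex_maxchain i j : i != j -> maxset (@chain d L) (hex_set i j).
Proof.
move=> ij; have [B_max [B0 B1]] := baseP.
have [B_chain B_out] := andP (maxsetp B_max).
have hex_chain : chain (hex_set i j).
  apply: chain_setU1.
    by apply: chain_setU1 => // y /base_comparable yS; rewrite comparable_sym yS.
  by move=> y /setU1P[->|/base_comparable yS]; rewrite comparable_sym ?atom_coatom ?yS.
apply/maxsetP; split=> // E E_chain hexE; apply/eqP; rewrite eqEsubset hexE andbT.
have E_comp x y : x \in E -> y \in E -> (x >=< y)%O by apply: (chainP _ E_chain).
have hexP x : x \in hex_set i j -> x \in E by move/(subsetP hexE).
have baseE : base \subset E.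
  apply: subset_trans hexE; rewrite /hex_set.
  by do 2!apply/(subset_trans _ (subsetUr _ _)).
apply/subsetP => x xE.
have [x_out|x_in] := boolP (x \in outside).
  suff xB : x \in base by rewrite !inE xB !orbT.
  have [_ B_maxP] := maxsetP B_max; rewrite -(B_maxP (x |: base)) ?setU11 ?subsetUr //.
  rewrite /outside_chain subUset sub1set B_out x_out !andbT.
  by apply: chain_setU1 => // y /(subsetP baseE) yE; apply: E_comp.
move: x_in; rewrite inE negb_or => /andP[x0 x1].
have /orP[x0'|x0'] := E_comp x (g set0) xE (subsetP baseE _ B0).
  by rewrite x0' in x0.
have /orP[x1'|x1'] := E_comp x (g setT) xE (subsetP baseE _ B1); last first.
  by rewrite x1' in x1.
have [_ g_surj] := g_cube; have [S xS] := g_surj x x0' x1'.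
have atomE : atom i \in E by apply: hexP; rewrite !inE eqxx orbT.
have coatomE : coatom j \in E by apply: hexP; rewrite !inE eqxx.
have := E_comp x _ xE atomE; have := E_comp x _ xE coatomE.
rewrite xS /Order.comparable !g_le => Si Sj.
have [k /andP[ki kj]] := third_index i j.
have iS : i \in S.
  apply: contraT => iNS; move: Sj; rewrite sub1set (negPf iNS) orbF.
  rewrite subset1 => /orP[/eqP S_i|/eqP S_0]; first by rewrite S_i inE eqxx in iNS.
  by rewrite xS S_0 lexx in x0.
have jS : j \notin S.
  apply: contraNN x1 => jS; rewrite xS g_le; apply/subsetP => l _.
  case/orP: Si => [/subsetP/(_ j jS)|/subsetP sub]; first by rewrite !inE eqxx.
  have [->|lj] := eqVneq l j; first exact: jS.
  by apply: sub; rewrite !inE.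
have [kS|kS] := boolP (k \in S).
  rewrite (_ : S = ~: [set j]) ?setU11 //; apply/setP => l; rewrite !inE.
  case: (index_cases l ij ki kj) => ->; first by rewrite iS ij.
    by rewrite (negPf jS) eqxx.
  by rewrite kS kj.
suff -> : S = [set i] by apply/setU1r/setU11.
apply/setP => l; rewrite !inE.
case: (index_cases l ij ki kj) => ->; first by rewrite iS eqxx.
  by rewrite (negPf jS) eq_sym (negPf ij).
by rewrite (negPf kS) (negPf ki).
Qed.

(** The base has multiplicity two in the product, hence lies in both factors, and
    the two incomparable atoms lie in different ones.  A factor that contains an
    atom with its own coatom is the given chain.  If the coatoms were exchanged,
    both atom indices would differ from both coatom indices, and thus be equal
    to the one remaining index. *)
Lemma hex_recombine i j i' j' E E' :
    i != j -> i' != j' -> i != i' -> j != j' ->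
    maxset (@chain d L) E -> maxset (@chain d L) E' ->
    (forall x, (x \in E) + (x \in E') =
               (x \in hex_set i j) + (x \in hex_set i' j'))%N ->
  (E = hex_set i j /\ E' = hex_set i' j') \/ (E = hex_set i' j' /\ E' = hex_set i j).
Proof.
move=> ij ij' ii' jj' E_max E'_max eq_count.
wlog iE : E E' E_max E'_max eq_count / atom i \in E.
  move=> IH; have [iE|iE] := boolP (atom i \in E); first exact: IH.
  have iE' : atom i \in E'.
    have := eq_count (atom i); rewrite (negPf iE) !atom_mem_hex eqxx.
    by case: (_ \in E').
  have [|[-> ->]|[-> ->]] := IH E' E E'_max E_max _ iE'.
  - by move=> x; rewrite addnC eq_count.
  - by right.
  by left.
have [E_chain _] := maxsetP E_max; have [E'_chain _] := maxsetP E'_max.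
have E_comp x y : x \in E -> y \in E -> (x >=< y)%O by apply: (chainP _ E_chain).
have E'_comp x y : x \in E' -> y \in E' -> (x >=< y)%O by apply: (chainP _ E'_chain).
have count x : ((x \in E) + (x \in E') =
   (x \in base).*2 + (x == atom i) + (x == atom i')
   + (x == coatom j) + (x == coatom j'))%N.
  by rewrite eq_count !mem_hex -addnn; ring.
have base_sub : (base \subset E) && (base \subset E').
  apply/andP; split; apply/subsetP => x xB; have := count x; rewrite xB;
    by case: (x \in E); case: (x \in E') => //=; rewrite ?addn0 ?add0n; lia.
have [baseE baseE'] := andP base_sub.
have ca := fun i => negPf (atom_notin_base i).
have cc := fun j => negPf (coatom_notin_base j).
have coatom_eq k l : (coatom k == coatom l) = (k == l) := inj_eq coatom_inj k l.
have ac k l : (atom k == coatom l) = false := negPf (atom_neq_coatom k l).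
have ca' k l : (coatom l == atom k) = false by rewrite eq_sym.
have i'E' : atom i' \in E'.
  have := count (atom i'); rewrite ca !atom_eq !ac eqxx [i' == i]eq_sym (negPf ii').
  have /negPf-> : atom i' \notin E; last by case: (_ \in E').
  by apply: contra ii' => i'E; rewrite -atom_comparable E_comp.
have full E1 k l : maxset (@chain d L) E1 -> base \subset E1 -> k != l ->
    atom k \in E1 -> coatom l \in E1 -> E1 = hex_set k l.
  move=> E1_max baseE1 kl kE1 lE1.
  have [_ hex_maxP] := maxsetP (hex_maxchain kl); apply: hex_maxP.
    by have [] := maxsetP E1_max.
  by rewrite !subUset !sub1set lE1 kE1.
have rest E1 E2 k l k' l' : maxset (@chain d L) E1 -> maxset (@chain d L) E2 ->
    (forall x, (x \in E1) + (x \in E2) = (x \in hex_set k l) + (x \in hex_set k' l'))%N ->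
    E1 = hex_set k l -> E2 = hex_set k' l'.
  move=> _ _ eq12 E1E; apply/setP => x; have := eq12 x; rewrite E1E => /addnI.
  by case: (_ \in _); case: (_ \in _).
have [jE|jE] := boolP (coatom j \in E).
  left; have EE := full E i j E_max baseE ij iE jE; split=> //.
  exact: (rest E E' i j i' j').
have jE' : coatom j \in E'.
  have := count (coatom j); rewrite cc !coatom_eq !ca' eqxx (negPf jE) (negPf jj').
  by case: (_ \in E').
have [j'E|j'E] := boolP (coatom j' \in E).
  have ij1 : i != j' by rewrite -atom_coatom E_comp.
  have i'j : i' != j by rewrite -atom_coatom E'_comp.
  have j'i : j' != i by rewrite eq_sym.
  have j'j : j' != j by rewrite eq_sym.
  have [/eqP|/eqP|/eqP] := index_cases i' ij j'i j'j.
  - by rewrite eq_sym (negPf ii').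
  - by rewrite (negPf i'j).
  by rewrite (negPf ij').
have j'E' : coatom j' \in E'.
  have := count (coatom j'); rewrite cc !coatom_eq !ca' eqxx (negPf j'E).
  rewrite [j' == j]eq_sym (negPf jj').
  by case: (_ \in E').
have E'E := full E' i' j' E'_max baseE' ij' i'E' j'E'.
have := mem_hex i' j' (coatom j); rewrite -E'E jE' cc ca' coatom_eq (negPf jj').
by [].
Qed.

End Hexagon.

Section CubeObstruction.
Variables (d : Order.disp_t) (L : finTBDistrLatticeType d).
Variables (g : {set 'I_3} -> L) (g_cube : cube g).
Implicit Types (i j : 'I_3) (x y : L).
Notation n := #|maxchain L|.
Notation e := (fun C : maxchain L => chain_mnm (@enum_rank L) (val C)).
Notation im := (mnm_image e).
Notation var C := (U_(enum_rank C)%MM : 'X_{1..n}).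

Lemma im_var (C : maxchain L) x :
  im (var C) (enum_rank x) = (x \in val C).
Proof. by rewrite mnm_imageU chain_mnmE //; apply: enum_rank_inj. Qed.

(** All maximal chains contain the bottom element. *)
Lemma mdeg_im (m : 'X_{1..n}) : mdeg m = im m (enum_rank (\bot%O : L)).
Proof.
rewrite mnm_imageE mdegE; apply: eq_bigr => k _.
rewrite chain_mnmE; last exact: enum_rank_inj.
rewrite (maxchain_mem (valP (enum_val k))) ?mul1n // => y _.
by rewrite le_comparable ?le0x.
Qed.

Definition hex i j (ij : i != j) : maxchain L := Sub _ (hex_maxchain g_cube ij).

Lemma hex_inj i j i' j' (ij : i != j) (ij' : i' != j') :
  hex ij = hex ij' -> i = i' /\ j = j'.
Proof.
move=> /(congr1 val)/= eq_hex; split; apply/eqP.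
  by have := atom_mem_hex g_cube i i j; rewrite eq_hex atom_mem_hex eqxx.
by have := coatom_mem_hex g_cube j i j; rewrite eq_hex coatom_mem_hex eqxx.
Qed.

Lemma mdeg2P (m : 'X_{1..n}) : mdeg m = 2 ->
  exists E E' : maxchain L, m = (var E + var E')%MM.
Proof.
move=> m2; have [k mk] : exists k, m k != 0%N.
  by apply: mnm_neq0; apply: contra_eq_neq m2 => ->; rewrite mdeg0.
have mE := var_dvd mk.
have /mdeg1P[l /eqP m1] : mdeg (m - U_(k))%MM == 1%N.
  by move: m2; rewrite {1}mE mdegD mdeg1 => -[]; rewrite add0n => ->.
by exists (enum_val k), (enum_val l); rewrite !enum_valK -m1.
Qed.

Lemma hex_pair_rigid i j i' j' (ij : i != j) (ij' : i' != j') :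
  i != i' -> j != j' -> rigid e (var (hex ij) + var (hex ij'))%MM.
Proof.
move=> ii' jj' m eq_im.
have /mdeg2P[E [E' mE]] : mdeg m = 2.
  by rewrite mdeg_im eq_im -mdeg_im mdegD !mdeg1.
have eq_count x : ((x \in val E) + (x \in val E') =
    (x \in hex_set g_cube i j) + (x \in hex_set g_cube i' j'))%N.
  have := congr1 (fun m : 'X_{1..#|L|} => m (enum_rank x)) eq_im.
  by rewrite mE !mnm_imageD !mnmDE !im_var.
have [[EE EE']|[EE EE']] :=
    hex_recombine ij ij' ii' jj' (valP E) (valP E') eq_count.
  by rewrite mE; congr (U_(enum_rank _) + U_(enum_rank _))%MM; apply: val_inj.
by rewrite mE addmC; congr (U_(enum_rank _) + U_(enum_rank _))%MM; apply: val_inj.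
Qed.

(** The six chains are the edges of the hexagon of atoms and coatoms, and the
    two cyclic orders of the indices give its two perfect matchings. *)
Definition matching i j k (ij : i != j) (jk : j != k) (ki : k != i) : 'X_{1..n} :=
  (var (hex ij) + var (hex jk) + var (hex ki))%MM.

(** A proper divisor divides the product of two disjoint edges. *)
Lemma matching_rigid i j k (ij : i != j) (jk : j != k) (ki : k != i) m :
  (m <= matching ij jk ki)%MM -> m != matching ij jk ki -> rigid e m.
Proof.
move=> /mnm_lepP le_m neq.
have [l lt_m] : exists l, (m l < matching ij jk ki l)%N.
  apply/existsP; apply: contraNT neq; rewrite negb_exists => /forallP ge_m.
  by apply/eqP/mnmP => l; apply/eqP; rewrite eqn_leq le_m leqNgt ge_m.
have hex_neq a b a' b' (ab : a != b) (ab' : a' != b') : a != a' ->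
    enum_rank (hex ab) != enum_rank (hex ab').
  by move=> aa'; rewrite (inj_eq enum_rank_inj); apply: contra_neq aa' => /hex_inj[].
have sub (m0 : 'X_{1..n}) : matching ij jk ki = (U_(l) + m0)%MM -> (m <= m0)%MM.
  move=> mE; apply/mnm_lepP => l'; have := le_m l'; move: lt_m.
  rewrite mE !mnmDE !mnm1E eqxx.
  by have [->|] := eqVneq l l'; lia.
have : matching ij jk ki l != 0%N by rewrite -lt0n (leq_ltn_trans _ lt_m).
rewrite !mnmDE !mnm1E !addn_eq0 !negb_and !eqb0 !negbK.
have rot (a b c : 'X_{1..n}) :
    (a + b + c = b + (a + c))%MM /\ (a + b + c = c + (a + b))%MM.
  by split; [rewrite [(a + b)%MM]addmC -addmA | rewrite addmC].
case/orP=> [/orP[]|] /eqP lE.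
- apply: (rigid_dvd (sub _ _) (hex_pair_rigid (ij := jk) (ij' := ki) _ _)) => //.
  by rewrite -lE /matching -addmA.
- apply: (rigid_dvd (sub _ _) (hex_pair_rigid (ij := ij) (ij' := ki) _ _)).
  + by rewrite -lE; apply: (rot _ _ _).1.
  + by rewrite eq_sym.
  + by rewrite eq_sym.
apply: (rigid_dvd (sub _ _) (hex_pair_rigid (ij := ij) (ij' := jk) _ _)) => //.
by rewrite -lE; apply: (rot _ _ _).2.
Qed.

(** Both perfect matchings cover every vertex of the hexagon once. *)
Lemma cube_critical_pair : exists u v, critical_pair e u v.
Proof.
have [i [j [k [ij jk ki]]]] : exists i j k : 'I_3, [/\ i != j, j != k & k != i].
  by exists (inord 0), (inord 1), (inord 2); rewrite -!val_eqE /= !inordK.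
have ji : j != i by rewrite eq_sym.
have kj : k != j by rewrite eq_sym.
have ik : i != k by rewrite eq_sym.
exists (matching ij jk ki), (matching ik kj ji); split.
- apply/mnmP => l; rewrite -(enum_valK l) /matching !mnm_imageD !mnmDE !im_var /=.
  by rewrite !mem_hex; ring.
- apply/eqP => /(congr1 (fun m : 'X_{1..n} => m (enum_rank (hex ij)))).
  have hexE a b (ab : a != b) : (U_(enum_rank (hex ab)) (enum_rank (hex ij)))%MM =
      ((a == i) && (b == j)) :> nat.
    rewrite mnm1E (inj_eq enum_rank_inj); congr nat_of_bool.
    apply/eqP/andP => [/hex_inj[-> ->]|[/eqP ai /eqP bj]]; first by rewrite !eqxx.
    by case: _ / (esym ai) ab; case: _ / (esym bj) => ab; apply: val_inj.
  rewrite !mnmDE !hexE !eqxx (negPf kj) (negPf ki) (negPf ji).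
  by rewrite andbF.
- by rewrite !mdegD !mdeg1.
- exact: matching_rigid.
exact: matching_rigid.
Qed.

End CubeObstruction.

(** * Sorting *)

Section Sorting.
Variable n : nat.
Implicit Types (m u v : 'X_{1..n}) (w : seq 'I_n) (l : 'I_n).

Lemma every_other_cons T b (x : T) (s : seq T) :
  every_other b (x :: s) = (if b then [::] else [:: x]) ++ every_other (~~ b) s.
Proof.
rewrite /every_other /mkseq /= (iotaDl 1 0) -map_comp.
have -> : map ((fun k => odd k == b) \o addn 1) (iota 0 (size s)) =
          map (fun k => odd k == ~~ b) (iota 0 (size s)).
  by apply: eq_map => k /=; case: (odd k); case: b.
by case: b.
Qed.

Lemma every_other_cat T b (s s' : seq T) :
  every_other b (s ++ s') = every_other b s ++ every_other (b (+) odd (size s)) s'.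
Proof.
elim: s b => [|x s IH] b; first by rewrite addbF.
by rewrite cat_cons !every_other_cons IH -catA /= addNb addbN.
Qed.

Lemma count_every_other_nseq (T : eqType) b (a : pred T) k x :
  count a (every_other b (nseq k x)) = (a x * (if b then k./2 else uphalf k))%N.
Proof.
elim: k b => [|k IH] b; first by case: b; rewrite muln0.
rewrite /= every_other_cons count_cat IH; case: b => //=.
by rewrite addn0 mulnS.
Qed.

Lemma indices_mnmE w l : indices_mnm w l = count_mem l w.
Proof.
rewrite mnm_sumE; elim: w => [|x w IH]; first by rewrite big_nil.
by rewrite big_cons IH mnm1E.
Qed.

Lemma count_every_other_notin (r : seq 'I_n) b m l : l \notin r ->
  count_mem l (every_other b (flatten [seq nseq (m i) i | i <- r])) = 0%N.
Proof.
elim: r b => [|x r IH] b; first by case: b.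
rewrite inE negb_or => /andP[lx lr]; rewrite /= every_other_cat count_cat IH //.
by rewrite count_every_other_nseq /= eq_sym (negPf lx).
Qed.

(** The entries of index l occupy consecutive positions of the sorted word,
    after those of smaller index; half of them, rounded according to the parity
    of the first position, go to either factor. *)
Lemma every_other_mnm b m l :
  indices_mnm (every_other b (mnm_indices m)) l =
  (if b (+) odd (\sum_(i < n | (i < l)%N) m i) then (m l)./2 else uphalf (m l)).
Proof.
rewrite indices_mnmE /mnm_indices.
have l_enum : l \in enum 'I_n by rewrite mem_enum.
have enum_uniq : uniq (enum 'I_n) by apply: enum_uniq.
have enum_lt : pairwise (fun i j : 'I_n => (i < j)%N) (enum 'I_n).
  rewrite -(pairwise_map val ltn) val_enum_ord -sorted_pairwise; last exact: ltn_trans.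
  exact: iota_ltn_sorted.
have sumE : (\sum_(i < n | (i < l)%N) m i = \sum_(i <- enum 'I_n | (i < l)%N) m i)%N.
  by rewrite big_enum_cond.
rewrite sumE; case/splitPr: l_enum enum_uniq enum_lt {sumE} => r1 r2.
rewrite cat_uniq /= negb_or => /and3P[_ /andP[lr1 _] /andP[lr2 _]].
rewrite pairwise_cat allrel_consr pairwise_cons.
case/and3P => /andP[r1_lt _] _ /andP[r2_lt _].
rewrite map_cat flatten_cat every_other_cat count_cat count_every_other_notin //.
rewrite add0n /= every_other_cat count_cat [X in (_ + X)%N]count_every_other_notin //.
rewrite addn0 count_every_other_nseq /= eqxx mul1n.
congr (if _ (+) odd _ then _ else _).
rewrite size_flatten /shape -map_comp sumnE big_map big_cat /= big_cons ltnn.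
rewrite [X in (_ + X)%N]big1_seq ?addn0; last first.
  by move=> i /andP[il /(allP r2_lt)]; rewrite ltnNge (ltnW il).
rewrite [RHS]big_mkcond; apply: eq_big_seq => i ir1 /=; rewrite size_nseq.
by rewrite ifT //; apply: (allP r1_lt).
Qed.

End Sorting.

(** The chords p q and r s interleave: among four distinct points of a
    line, p and q have positions of the same parity.  Sorting yields the
    condition in this form. *)
Definition interleave (p q r s : nat) : bool :=
  (q < p)%N (+) (r < p)%N (+) (s < p)%N == (p < q)%N (+) (r < q)%N (+) (s < q)%N.

(** The disjoint edges of a hexagon cannot all interleave.  Three pairwise
    interleaving chords on six points join the points at distance three, so
    that the first point would have the same neighbour in both perfect
    matchings. *)
Lemma hexagon_not_interleaved (a b : 'I_3 -> nat) :
    injective a -> injective b -> (forall i j, a i != b j) ->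
    (forall i j i' j', i != j -> i' != j' -> i != i' -> j != j' ->
      interleave (a i) (b j) (a i') (b j')) ->
  False.
Proof.
have least (c e : 'I_3 -> nat) i : injective c -> injective e ->
    (forall i j, c i != e j) -> (forall j, c i <= c j)%N -> (forall j, c i <= e j)%N ->
    (forall i j i' j', i != j -> i' != j' -> i != i' -> j != j' ->
      interleave (c i) (e j) (c i') (e j')) -> False.
  move=> c_inj e_inj ce c_min e_min H.
  have [j /andP[ji _]] := third_index i i; have [k /andP[ki kj]] := third_index i j.
  have ij : i != j by rewrite eq_sym. 
  have ik : i != k by rewrite eq_sym.
  have jk : j != k by rewrite eq_sym.
  have := H i j k i ij ki ik ji; have := H i j j i ij ji ij ji.
  have := H i j j k ij jk ij jk; have := H i k k j ik kj ik kj.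
  have := H i k k i ik ki ik ki; have := H i k j i ik ji ij ki.
  have neq x y : x != y -> (c x != c y) /\ (e x != e y).
    by move=> xy; rewrite (inj_eq c_inj) (inj_eq e_inj).
  have [n1 n2] := neq _ _ ij; have [n3 n4] := neq _ _ ik; have [n5 n6] := neq _ _ jk.
  have := (ce i i, ce i j, ce i k, ce j i, ce j j, ce j k, ce k i, ce k j, ce k k).
  have := (c_min j, c_min k, e_min i, e_min j, e_min k).
  rewrite /interleave.
  move: (c i) (c j) (c k) (e i) (e j) (e k) n1 n2 n3 n4 n5 n6.
  move=> z0 z4 z2 z3 z1 z5 n1 n2 n3 n4 n5 n6 [[[[m1 m2] m3] m4] m5].
  move=> [[[[[[[[q1 q2] q3] q4] q5] q6] q7] q8] q9].
  have l0 z : (z0 <= z)%N -> (z < z0)%N = false by rewrite leqNgt => /negPf.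
  have l1 z : (z0 <= z)%N -> z0 != z -> (z0 < z)%N by rewrite ltn_neqAle => -> ->.
  rewrite !l0 // (l1 z1) // (l1 z5) //=.
  move=> /eqP h1 /eqP h2 /eqP h3 /eqP h4 /eqP h5 /eqP h6.
  have [lt21|lt12] := ltnP z2 z1; lia.
move=> a_inj b_inj ab H.
have [x x_min] : exists x : 'I_3 + 'I_3, forall y,
    ((if x is inl i then a i else if x is inr j then b j else 0) <=
     (if y is inl i then a i else if y is inr j then b j else 0))%N.
  by have [x _ x_min] := @arg_minnP _ (inl ord0 : 'I_3 + 'I_3) predT
      (fun x => if x is inl i then a i else if x is inr j then b j else 0%N) isT;
     exists x => y; apply: x_min.
case: x x_min => i i_min.
  by apply: (least a b i) => // j; [apply: (i_min (inl j)) | apply: (i_min (inr j))].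
apply: (least b a i) => //.
- by move=> j k; rewrite eq_sym.
- by move=> j; apply: (i_min (inr j)).
- by move=> j; apply: (i_min (inl j)).
move=> j k j' k' jk jk' jj' kk'; have := H k j k' j'.
rewrite [k == j]eq_sym [k' == j']eq_sym => /(_ jk jk' kk' jj').
rewrite /interleave => /eqP h; apply/eqP; move: h.
by do 6!case: (_ < _)%N.
Qed.

Section CubeNotSortable.
Variables (d : Order.disp_t) (L : finTBDistrLatticeType d).
Variables (g : {set 'I_3} -> L) (g_cube : cube g).
Variables (lab : L -> 'I_#|L|).
Hypothesis lab_bij : bijective lab.
Implicit Types (i j : 'I_3) (x y : L).

Lemma mnm_before m x :
  (\sum_(k < #|L| | (k < lab x)%N) m k = \sum_(y : L) (lab y < lab x)%N * m (lab y))%N.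
Proof.
rewrite (reindex lab) /=; last exact: onW_bij.
by rewrite big_mkcond; apply: eq_bigr => y _; case: (_ < _)%N; rewrite ?mul1n ?mul0n.
Qed.

Let lab_inj : injective lab := bij_inj lab_bij.

Lemma hex_before i j i' j' x (ij : i != j) (ij' : i' != j') :
  odd (\sum_(k < #|L| | (k < lab x)%N)
    (chain_mnm lab (hex_set g_cube i j) + chain_mnm lab (hex_set g_cube i' j'))%MM k) =
  (lab (atom g i) < lab x)%N (+) (lab (coatom g j) < lab x)%N
  (+) (lab (atom g i') < lab x)%N (+) (lab (coatom g j') < lab x)%N.
Proof.
rewrite mnm_before.
have single (z : L) : (\sum_(y : L) (lab y < lab x) * (y == z) = (lab z < lab x))%N.
  rewrite (bigD1 z) //= eqxx muln1 big1 ?addn0 // => y /negPf->.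
  by rewrite muln0.
have -> : (\sum_(y : L) (lab y < lab x) * (chain_mnm lab (hex_set g_cube i j) +
      chain_mnm lab (hex_set g_cube i' j'))%MM (lab y) =
    (\sum_(y : L) (lab y < lab x) * (y \in base g_cube)).*2
    + (lab (atom g i) < lab x) + (lab (coatom g j) < lab x)
    + (lab (atom g i') < lab x) + (lab (coatom g j') < lab x))%N.
  rewrite -!single -muln2 big_distrl -!big_split /=; apply: eq_bigr => y _.
  by rewrite mnmDE !chain_mnmE // !mem_hex; lia.
by rewrite !oddD odd_double !oddb.
Qed.

(** Sorting the product of two disjoint edges returns these edges, by
    hex_recombine, so that the atom and the coatom of an edge have positions of
    the same parity. *)
Lemma cube_interleave i j i' j' :
    sortable_set (fun u => exists C : maxchain L, u = chain_mnm lab (val C)) ->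
    i != j -> i' != j' -> i != i' -> j != j' ->
  interleave (lab (atom g i)) (lab (coatom g j)) (lab (atom g i')) (lab (coatom g j')).
Proof.
case=> _ sortP ij ij' ii' jj'.
have [[E EE] [E' EE']] := sortP _ _ (ex_intro _ (hex g_cube ij) erefl)
                                    (ex_intro _ (hex g_cube ij') erefl).
set m := (chain_mnm lab (val (hex g_cube ij)) + chain_mnm lab (val (hex g_cube ij')))%MM.
have mE x : m (lab x) = ((x \in hex_set g_cube i j) + (x \in hex_set g_cube i' j'))%N.
  by rewrite mnmDE !chain_mnmE.
have memE x : (x \in val E : nat) =
    if odd (\sum_(k < #|L| | (k < lab x)%N) m k) then (m (lab x))./2
    else uphalf (m (lab x)).
  by rewrite -(chain_mnmE (val E) x lab_inj) -EE every_other_mnm addFb.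
have memE' x : (x \in val E' : nat) =
    if odd (\sum_(k < #|L| | (k < lab x)%N) m k) then uphalf (m (lab x))
    else (m (lab x))./2.
  by rewrite -(chain_mnmE (val E') x lab_inj) -EE' every_other_mnm addTb if_neg.
have m_def : m = (chain_mnm lab (hex_set g_cube i j)
                  + chain_mnm lab (hex_set g_cube i' j'))%MM by [].
clearbody m.
have eq_count x : ((x \in val E) + (x \in val E') =
    (x \in hex_set g_cube i j) + (x \in hex_set g_cube i' j'))%N.
  by rewrite memE memE' mE; case: odd; case: (_ \in _); case: (_ \in _).
have once x : m (lab x) = 1%N ->
    (x \in val E) = ~~ odd (\sum_(k < #|L| | (k < lab x)%N) m k).
  by move=> m1; have := memE x; rewrite m1; case: odd; case: (_ \in _).
have same : (atom g i \in val E) = (coatom g j \in val E).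
  have [[-> _]|[-> _]] := hex_recombine ij ij' ii' jj' (valP E) (valP E') eq_count.
    by rewrite atom_mem_hex coatom_mem_hex !eqxx.
  by rewrite atom_mem_hex coatom_mem_hex (negPf ii') (negPf jj').
have m_atom : m (lab (atom g i)) = 1%N by rewrite mE !atom_mem_hex eqxx (negPf ii').
have m_coatom : m (lab (coatom g j)) = 1%N.
  by rewrite mE !coatom_mem_hex eqxx (negPf jj').
move: same; rewrite !once // m_def => /negb_inj; rewrite !hex_before // !ltnn.
rewrite /interleave => eq_odd; apply/eqP; move: eq_odd.
by do 6!case: (_ < _)%N.
Qed.

End CubeNotSortable.

Lemma cube_not_sortable d (L : finTBDistrLatticeType d) (g : {set 'I_3} -> L) :
  cube g -> ~ sortable L.
Proof.
move=> g_cube [lab [lab_bij lab_sort]]; have lab_inj := bij_inj lab_bij.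
apply: (@hexagon_not_interleaved (lab \o atom g) (lab \o coatom g)) => /=.
- by move=> i i' /val_inj/lab_inj/eqP; rewrite (atom_eq g_cube) => /eqP.
- by move=> j j' /val_inj/lab_inj/(coatom_inj g_cube).
- move=> i j; apply/eqP => /val_inj/lab_inj/eqP.
  by rewrite (negPf (atom_neq_coatom g_cube i j)).
by move=> i j i' j'; apply: cube_interleave.
Qed.

Section PlanarSortable.
Variables (d : Order.disp_t) (L : finTBDistrLatticeType d).
Variable pc : plane_coordinates L.
Notation i := (coord1 pc).
Notation h := (height pc).
Implicit Types (C D : maxchain L) (x y : L).

(** The label increases with the rank and, within a rank, with the first
    coordinate: the two elements of a given rank of two chains are then adjacent
    in the sorted product, and sorting gives the meet and the join. *)
Definition sort_key x := (coord_rk pc x * h.+1 + i x)%N.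

Lemma sort_key_lt x y : (sort_key x < sort_key y)%N =
  (coord_rk pc x < coord_rk pc y)%N || (coord_rk pc x == coord_rk pc y) && (i x < i y)%N.
Proof.
have ix : (i x < h.+1)%N by have := coord_height pc x; lia.
have iy : (i y < h.+1)%N by have := coord_height pc y; lia.
rewrite /sort_key; case: (ltngtP (coord_rk pc x) (coord_rk pc y)) => [lt|gt|->] /=.
- by nia.
- by apply/negbTE; rewrite -leqNgt; nia.
by rewrite ltn_add2l.
Qed.

Lemma sort_key_inj : injective sort_key.
Proof.
move=> x y eq_key; have [] := (sort_key_lt x y, sort_key_lt y x).
rewrite eq_key ltnn => /esym/negbT; rewrite negb_or -leqNgt => /andP[rk1 i1].
move=> /esym/negbT; rewrite negb_or -leqNgt => /andP[rk2 i2].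
have eq_rk : coord_rk pc x = coord_rk pc y by apply/eqP; rewrite eqn_leq rk1 rk2.
move: i1 i2; rewrite eq_rk eqxx /= -!leqNgt => i1 i2.
by apply: (coord_inj eq_rk); apply/eqP; rewrite eqn_leq i1 i2.
Qed.

Lemma sort_label_subproof x : (#|[set y | (sort_key y < sort_key x)%N]| < #|L|)%N.
Proof.
rewrite -cardsT; apply/proper_card/properP; split; first exact: subsetT.
by exists x; rewrite !inE ?ltnn.
Qed.

Definition sort_label x : 'I_#|L| := Ordinal (sort_label_subproof x).

Lemma sort_label_lt x y : (sort_label x < sort_label y)%N = (sort_key x < sort_key y)%N.
Proof.
have mono u v : (sort_key u < sort_key v)%N -> (sort_label u < sort_label v)%N.
  move=> uv; apply/proper_card/properP; split; last by exists u; rewrite !inE ?ltnn.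
  by apply/subsetP => z; rewrite !inE => /ltn_trans; apply.
apply/idP/idP => [|/mono//]; apply: contraTT; rewrite -!leqNgt leq_eqVlt.
by case/predU1P => [/sort_key_inj->|/mono/ltnW].
Qed.

Lemma sort_label_inj : injective sort_label.
Proof.
move=> x y eq_lab; have := sort_label_lt x y; have := sort_label_lt y x.
rewrite eq_lab ltnn => /esym/negbT; rewrite -leqNgt => le1.
move=> /esym/negbT; rewrite -leqNgt => le2.
by apply/sort_key_inj/eqP; rewrite eqn_leq le1 le2.
Qed.

Lemma sort_label_bij : bijective sort_label.
Proof. by apply: (inj_card_bij sort_label_inj); rewrite card_ord. Qed.

Lemma card_maxchain C : #|val C| = h.+1.
Proof.
have -> : val C = [set chain_at C r | r : 'I_h.+1].
  apply/setP => x; rewrite (mem_maxchain pc); apply/eqP/imsetP => [->|[r _ xr]].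
    by exists (Ordinal (coord_rk_lt pc x)).
  by apply: chain_atE; rewrite // xr chain_at_mem.
rewrite card_imset ?card_ord // => r r' /(congr1 (coord_rk pc)).
by rewrite !chain_at_rk => /val_inj.
Qed.

Lemma mdeg_chain_mnm n (lab : L -> 'I_n) (C : {set L}) : mdeg (chain_mnm lab C) = #|C|.
Proof. by rewrite mdeg_sum -sum1_card; apply: eq_bigr => x _; rewrite mdeg1. Qed.

Lemma chain_before C x :
  (\sum_(y : L) (sort_label y < sort_label x) * (y \in val C) =
   coord_rk pc x + (i (chain_at C (Ordinal (coord_rk_lt pc x))) < i x))%N.
Proof.
set r := Ordinal _.
have -> : (\sum_(y : L) (sort_label y < sort_label x) * (y \in val C) =
    \sum_(y in val C) (sort_key y < sort_key x))%N.
  rewrite [RHS]big_mkcond; apply: eq_bigr => y _; rewrite sort_label_lt.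
  by case: (_ \in _); rewrite ?muln1 ?muln0.
have -> : (\sum_(y in val C) (sort_key y < sort_key x) =
    \sum_(r' < h.+1) (sort_key (chain_at C r') < sort_key x))%N.
  rewrite (reindex (@chain_at d L pc C)) /=.
    by apply: eq_bigl => r'; rewrite chain_at_mem.
  exists (fun y => Ordinal (coord_rk_lt pc y)) => [r' _|y yC].
    by apply: val_inj; rewrite /= chain_at_rk.
  by apply/esym/chain_atE.
under eq_bigr do rewrite sort_key_lt chain_at_rk.
rewrite (bigD1 r) //= ltnn eqxx /= addnC; congr (_ + _)%N.
have r_le : (coord_rk pc x <= h.+1)%N by apply/ltnW/coord_rk_lt.
rewrite -[RHS]card_ord -sum1_card (big_ord_widen _ (fun=> 1%N) r_le) big_mkcond /=.
rewrite [RHS]big_mkcond /=; apply: eq_bigr => r' _.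
case: eqP => [->|/eqP r'r]; first by rewrite /= ltnn.
have -> : (r' == coord_rk pc x :> nat) = false.
  by apply/negbTE; apply: contraNneq r'r => r'E; apply/eqP/val_inj.
by rewrite orbF; case: (_ < _)%N.
Qed.

Lemma sort_chains C D b :
  indices_mnm (every_other b (mnm_indices
    (chain_mnm sort_label (val C) + chain_mnm sort_label (val D))%MM)) =
  chain_mnm sort_label (val (chain_select pc b C D)).
Proof.
apply/mnmP => l; rewrite every_other_mnm; have [lab' labK lab'K] := sort_label_bij.
rewrite -(lab'K l); move: (lab' l) => {l lab' labK lab'K} x.
rewrite (mnm_before sort_label_bij) mnmDE !chain_mnmE; try exact: sort_label_inj.
have -> : (\sum_(y : L) (sort_label y < sort_label x) *
      (chain_mnm sort_label (val C) + chain_mnm sort_label (val D))%MM (sort_label y) =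
    \sum_(y : L) (sort_label y < sort_label x) * (y \in val C) +
    \sum_(y : L) (sort_label y < sort_label x) * (y \in val D))%N.
  rewrite -big_split /=; apply: eq_bigr => y _.
  by rewrite mnmDE !chain_mnmE ?mulnDr //; exact: sort_label_inj.
rewrite !chain_before addnACA addnn oddD odd_double addFb oddD !oddb.
rewrite !(mem_maxchain pc) chain_at_select; set r := Ordinal _.
have eq_i y : coord_rk pc y = r -> (x == y) = (i x == i y).
  move=> yr; apply/eqP/eqP => [->//|]; apply: coord_inj.
  by rewrite yr.
rewrite !eq_i ?select_rk ?chain_at_rk // i_select.
move: (i _) (i _) (i _) => q t p.
by case: b; case: (ltngtP p t) => ?; case: (ltngtP q t) => ?; rewrite /=; lia.
Qed.

Lemma planar_sortable : sortable L.
Proof.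
exists sort_label; split; first exact: sort_label_bij.
split=> [_ _ [C ->] [D ->]|_ _ [C ->] [D ->]].
  by rewrite !mdeg_chain_mnm !card_maxchain.
by rewrite /sort_mnm /= !sort_chains; split; eexists.
Qed.

End PlanarSortable.

(** * The equivalence *)

Theorem theorem3p4 (d : Order.disp_t) (L : finTBDistrLatticeType d)
    (K : fieldType) :
  [<-> planar L;
       sortable L;
       has_quadratic_drl_gb (@chain_ideal K d L);
       quadratically_generated (@chain_ideal K d L);
       koszul (@chain_grading K d L);
       exists (d' : Order.disp_t) (M : finTBDistrLatticeType d'),
         graded_iso (@chain_grading K d L) (@hibi_grading K d' M)].
Proof.
have coords : planar L -> inhabited (plane_coordinates L) := @planar_coordinates d L.
have no_cube (Q : Prop) : ((exists g, @cube d L g) -> ~ Q) -> Q -> planar L.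
  by move=> cubeQ q; case: (planar_or_cube L) => // /cubeQ.
have critical g : @cube d L g -> exists u v,
    critical_pair (fun C : maxchain L => chain_mnm (@enum_rank L) (val C)) u v.
  exact: cube_critical_pair.
have sortable_planar : sortable L -> planar L.
  by apply: no_cube => -[g /cube_not_sortable].
have gb_planar : has_quadratic_drl_gb (@chain_ideal K d L) -> planar L.
  by apply: no_cube => -[g /critical[u [v /(critical_no_quadratic_gb (K := K))]]].
have quadratic_planar : quadratically_generated (@chain_ideal K d L) -> planar L.
  by apply: no_cube => -[g /critical[u [v /(critical_not_quadratic (K := K))]]].
have koszul_planar : koszul (@chain_grading K d L) -> planar L.
  apply: no_cube => -[g /critical[u [v uvP]]].
  exact: (critical_not_koszul uvP (@chain_pi_eq0 K d L) (@chain_pi_surj K d L)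
            (@chain_gradingE K d L)).
have planar_hibi : planar L -> exists (d' : Order.disp_t) (M : finTBDistrLatticeType d'),
    graded_iso (@chain_grading K d L) (@hibi_grading K d' M).
  by case/coords => pc; exists d, (chain_lattice pc); apply: chain_to_hibi_iso.
have hibi_koszul_chain : (exists (d' : Order.disp_t) (M : finTBDistrLatticeType d'),
    graded_iso (@chain_grading K d L) (@hibi_grading K d' M)) ->
    koszul (@chain_grading K d L).
  by case=> d' [M isoM]; apply: koszul_graded_iso isoM (hibi_koszul K M).
do !split.
- by case/coords => pc; apply: planar_sortable pc.
- by case/sortable_planar/coords => pc; apply: planar_quadratic_gb pc.
- by case/gb_planar/coords => pc; apply: planar_quadratically_generated pc.
- by move/quadratic_planar/planar_hibi.
- by move/koszul_planar.
by move/hibi_koszul_chain.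
Qed.
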